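(* Let $M(n)$ denote the largest possible number of triangles with maximum area formed by $n$ lines in the Euclidean plane. Then $$\frac{7}{5}n-O(1)< M(n) < \frac{2}{3}n(n-2),$$ i.e. there is a constant $C$ such that $M(n)>\frac75 n - C$ for all $n$, and $M(n)<\frac23 n(n-2)$.
   Context: A triangle formed by a set of lines is a triangle whose three sides lie on three distinct lines of the set (a triple of pairwise non-parallel, non-concurrent lines). For an arrangement of $n$ distinct lines in the plane, consider the maximum of the areas of the triangles formed by triples of its lines, and count the triples forming a triangle of that maximum area; $M(n)$ is the maximum of this count over all arrangements of $n$ lines.
   Formalization: The upper bound M(n) < (2/3)n(n-2) is stated for n ≥ 3 only, since for n = 0, 1, 2 there are no triangles, M(n) = 0, and the strict inequality fails; the lower bound is stated for all n. *)

(* Defs.v *)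
From mathcomp Require Import all_boot all_order all_algebra.
From mathcomp Require Import all_classical all_reals.
Set Implicit Arguments.
Unset Strict Implicit.
Unset Printing Implicit Defensive.
Import Order.TTheory GRing.Theory Num.Theory.
Local Open Scope classical_set_scope.
Local Open Scope ring_scope.

Section Lines.
Variable R : realType.

Definition is_line (A : set (R * R)) : Prop :=
  exists a b c : R,
    (a, b) <> (0, 0) /\ A = [set p | a * p.1 + b * p.2 = c].

Definition parallel (A B : set (R * R)) : Prop := A = B \/ A `&` B = set0.

Definition concurrent (A B C : set (R * R)) : Prop :=
  exists p, [/\ A p, B p & C p].

Definition forms_triangle (A B C : set (R * R)) : Prop :=
  [/\ ~ parallel A B, ~ parallel B C, ~ parallel A C & ~ concurrent A B C].

(* Only meaningful for non-parallel lines, where [xget] returns the unique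
   common point. *)
Definition meeting_point (A B : set (R * R)) : R * R := xget (0, 0) (A `&` B).

Definition area (p q r : R * R) : R :=
  `|(q.1 - p.1) * (r.2 - p.2) - (r.1 - p.1) * (q.2 - p.2)| / 2.

Definition triangle_area (A B C : set (R * R)) : R :=
  area (meeting_point B C) (meeting_point A C) (meeting_point A B).

Definition arrangement (n : nat) (L : 'I_n -> set (R * R)) : Prop :=
  injective L /\ forall i, is_line (L i).

Definition triple (n : nat) : finType := ('I_n * 'I_n * 'I_n)%type.

(* A triple (i, j, k) with i < j < k stands for the unordered triple of lines
   {L i, L j, L k}, so that each triangle is counted once. *)
Definition triangle (n : nat) (L : 'I_n -> set (R * R)) (t : triple n) : Prop :=
  let: (i, j, k) := t in
  [/\ (i < j)%N, (j < k)%N & forms_triangle (L i) (L j) (L k)].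

Definition area_of (n : nat) (L : 'I_n -> set (R * R)) (t : triple n) : R :=
  let: (i, j, k) := t in triangle_area (L i) (L j) (L k).

Definition max_area_triangle (n : nat) (L : 'I_n -> set (R * R))
    (t : triple n) : Prop :=
  triangle L t /\ forall u, triangle L u -> area_of L u <= area_of L t.

Definition nb_max_area (n : nat) (L : 'I_n -> set (R * R)) : nat :=
  #|[pred t : triple n | `[< max_area_triangle L t >]]|.

Definition realizable (n m : nat) : Prop :=
  exists L : 'I_n -> set (R * R), arrangement L /\ nb_max_area L = m.

(* The largest realizable count: counts never exceed #|triple n|, so the range
   of the maximum is no restriction (see M_attained and M_upper_bound). *)
Definition M (n : nat) : nat :=
  \max_(m < #|triple n|.+1 | `[< realizable n m >]) (m : nat).

Lemma arrangement_exists (n : nat) :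
  exists L : 'I_n -> set (R * R), arrangement L.
Proof.
exists (fun i => [set p : R * R | 0 * p.1 + 1 * p.2 = (i : nat)%:R]); split.
  move=> i j /= /seteqP[/(_ (0, (i : nat)%:R)) /= + _].
  rewrite !mul1r mul0r add0r => /(_ erefl) /eqP.
  by rewrite eqr_nat => /eqP /val_inj.
by move=> i; exists 0, 1, (i : nat)%:R; split=> // -[/eqP]; rewrite oner_eq0.
Qed.

Lemma M_upper_bound (n : nat) (L : 'I_n -> set (R * R)) :
  arrangement L -> (nb_max_area L <= M n)%N.
Proof.
move=> LA; have lt : (nb_max_area L < #|triple n|.+1)%N.
  by rewrite ltnS; exact: max_card.
apply: (@leq_bigmax_cond _ _ (fun m : 'I__ => m : nat) (Ordinal lt)).
by apply/asboolP; exists L.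
Qed.

Lemma M_attained (n : nat) :
  exists L : 'I_n -> set (R * R), arrangement L /\ nb_max_area L = M n.
Proof.
have [L LA] := arrangement_exists n.
have lt : (nb_max_area L < #|triple n|.+1)%N.
  by rewrite ltnS; exact: max_card.
have P0 : `[< realizable n (Ordinal lt) >] by apply/asboolP; exists L.
have [|m /asboolP[L' [LA' e]] em] := @eq_bigmax_cond _
    [pred m : 'I_(#|triple n|.+1) | `[< realizable n m >]]
    (fun m : 'I__ => m : nat).
- by apply/card_gt0P; exists (Ordinal lt).
- by exists L'; split=> //; rewrite e /M -em.
Qed.

End Lines.

(* Main.v *)
Require Import Defs.
From mathcomp Require Import all_boot all_order all_algebra.
From mathcomp Require Import all_classical all_reals.
From mathcomp Require Import ring lra zify.
Set Implicit Arguments.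
Unset Strict Implicit.
Unset Printing Implicit Defensive.
Import Order.TTheory GRing.Theory Num.Theory.
Local Open Scope ring_scope.

(** Upper bound.  Fix a line [l] of the arrangement and take it as first axis;
    another line is then a point [(x, k)], with [x] its trace on [l] and [k] its
    inverse slope, and the area cut out by [l] and two lines is proportional to
    [dx ^ 2 / |dk|].  After rescaling, any two points satisfy
    [dx ^ 2 <= |dk|] or [dk = 0], with equality for the triangles of maximum
    area.  On one side of [l] these triangles are the edges of a graph in which
    no vertex has neighbours both to its left and to its right, and in which
    each edge is the longest one at its left end or at its right end, so that
    there are at most [(n - 1) - 1] edges.  Summing over both sides and over all
    lines counts each triangle three times and gives [2 n (n - 2) / 3].  The
    inequality is strict: if the vertex of the arrangement farthest from a given
    point lies on the lines [l] and [b], then all vertices of [b] are on one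
    side of [l], so [b] is isolated in the graph of the other side.

    Lower bound, with [3 n / 2 - O(1)] triangles.  The lines
    [x = t - t ^ 2 + t ^ 2 y] all cut out area [1 / 2] with [x = 0] and [y = 1].
    For [t] near [3 / 4], two consecutive ones have a common companion line
    which cuts out area [1 / 2] with each of them and [y = 0].  Lines of one
    family are so close to each other, and the remaining triangles are so small,
    that no triangle has larger area; each tangent line then contributes three
    triangles for itself and its companion. *)

(** * Lines in coordinates *)

Section Coordinates.
Variable R : realType.
Implicit Types (u v w : R * R * R) (p : R * R).

Definition locus u : set (R * R) :=
  [set p | u.1.1 * p.1 + u.1.2 * p.2 = u.2]%classic.

Definition proper_coef u : bool := u.1 != (0, 0).

Definition cross u v : R := u.1.1 * v.1.2 - v.1.1 * u.1.2.

(** The determinant of the 3 by 3 matrix of coefficients, expanded along the column of constant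
    terms. With it, [area3] is the classical area formula in terms of the side lines. *)
Definition det3 u v w : R :=
  u.2 * cross v w - v.2 * cross u w + w.2 * cross u v.

Definition area3 u v w : R :=
  det3 u v w ^+ 2 / (2 * `|cross u v * cross v w * cross u w|).

Definition tri u v w : bool :=
  [&& cross u v != 0, cross v w != 0, cross u w != 0 & det3 u v w != 0].

Lemma proper_norm u : proper_coef u -> 0 < u.1.1 ^+ 2 + u.1.2 ^+ 2.
Proof.
move=> pu; rewrite lt_neqAle addr_ge0 ?sqr_ge0 // andbT eq_sym.
by rewrite paddr_eq0 ?sqr_ge0 // !sqrf_eq0; case: u pu => [[a b] c].
Qed.

Definition cramer u v : R * R :=
  ((u.2 * v.1.2 - v.2 * u.1.2) / cross u v,
   (u.1.1 * v.2 - v.1.1 * u.2) / cross u v).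

Lemma cramerP u v p : cross u v != 0 -> locus u p -> locus v p -> p = cramer u v.
Proof.
case: p => p q; rewrite /locus /cramer /= => uv0 <- <-.
by congr (_, _); move: uv0; rewrite /cross => uv0; field.
Qed.

Lemma cramer_l u v : cross u v != 0 -> locus u (cramer u v).
Proof. by rewrite /locus /cramer /cross /= => uv0; field. Qed.

Lemma cramer_r u v : cross u v != 0 -> locus v (cramer u v).
Proof. by rewrite /locus /cramer /cross /= => uv0; field. Qed.

Lemma meeting_point_locus u v :
  cross u v != 0 -> meeting_point (locus u) (locus v) = cramer u v.
Proof.
move=> uv0; apply: xget_unique.
  by split; [exact: cramer_l | exact: cramer_r].
by move=> p [pu pv]; exact: cramerP.
Qed.

Lemma parallel_locus u v : proper_coef u -> proper_coef v ->
  parallel (locus u) (locus v) <-> cross u v = 0.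
Proof.
move=> pu pv; split.
  move=> par; apply/eqP; case: (eqVneq (cross u v) 0) => // uv0; exfalso.
  case: par => [E|E].
    have [mu mv] := (cramer_l uv0, cramer_r uv0).
    (* The common point moved along the direction of [u]: if the two lines were equal, it would be a
       second common point. *)
    pose q : R * R := ((cramer u v).1 - u.1.2, (cramer u v).2 + u.1.1).
    have qu : locus u q by rewrite /q; move: (cramer u v) mu => c; rewrite /locus /= => <-; ring.
    have qv : locus v q by rewrite -E.
    have := cramerP uv0 qu qv; rewrite /q => e.
    have e1 : - u.1.2 = 0 by have := congr1 fst e => /= /eqP; rewrite -subr_eq0 addrC addKr => /eqP.
    have e2 : u.1.1 = 0 by have := congr1 snd e => /= /eqP; rewrite -subr_eq0 addrC addKr => /eqP.
    by move: uv0; rewrite /cross e2 -(opprK u.1.2) e1 oppr0 mulr0 mul0r subr0 eqxx.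
  have : (locus u `&` locus v)%classic (cramer u v).
    by split; [exact: cramer_l | exact: cramer_r].
  by rewrite E.
move=> uv0; have [[p [pu' pv']]|] := pselect (exists p, locus u p /\ locus v p).
  left; apply/seteqP.
  have aux u' v' q : proper_coef u' -> cross u' v' = 0 ->
      locus u' p -> locus v' p -> locus u' q -> locus v' q.
    rewrite /locus /= => {pu pv uv0 pu' pv'} pu uv0 up vp uq.
    have N0 := proper_norm pu; rewrite -vp; apply: (mulfI (lt0r_neq0 N0)).
    have : u'.1.1 * (q.1 - p.1) + u'.1.2 * (q.2 - p.2) = 0.
      by rewrite !mulrBr addrACA -opprD uq up subrr.
    move: uv0; rewrite /cross; move: (u'.1.1) (u'.1.2) (v'.1.1) (v'.1.2).
    move=> a b a' b' uv0 E; apply/eqP; rewrite -subr_eq0.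
    (* Decomposition of [(a', b')] along [(a, b)] and its normal; both terms on the right vanish. *)
    have -> : (a ^+ 2 + b ^+ 2) * (a' * q.1 + b' * q.2)
       - (a ^+ 2 + b ^+ 2) * (a' * p.1 + b' * p.2) =
       (a * a' + b * b') * (a * (q.1 - p.1) + b * (q.2 - p.2)) +
       (a * b' - a' * b) * (a * (q.2 - p.2) - b * (q.1 - p.1)) by ring.
    by rewrite uv0 E mulr0 mul0r addr0.
  split=> q; first exact: aux.
  by apply: aux => //; move: uv0; rewrite /cross => uv0; rewrite -[RHS]oppr0 -uv0; ring.
by move=> np; right; rewrite -subset0 => p pp; apply: np; exists p.
Qed.

Lemma concurrent_locus u v w : cross u v != 0 -> cross v w != 0 ->
  cross u w != 0 ->
  concurrent (locus u) (locus v) (locus w) <-> det3 u v w = 0.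
Proof.
move=> uv0 vw0 uw0; have vw : locus w (cramer u v) <-> det3 u v w = 0.
  rewrite /locus /det3 /cramer /=.
  have -> : (w.1.1 * ((u.2 * v.1.2 - v.2 * u.1.2) / cross u v) +
   w.1.2 * ((u.1.1 * v.2 - v.1.1 * u.2) / cross u v) = w.2) <->
   (w.1.1 * ((u.2 * v.1.2 - v.2 * u.1.2)) +
   w.1.2 * ((u.1.1 * v.2 - v.1.1 * u.2)) = w.2 * cross u v).
    rewrite !mulrA -mulrDl; split => [<-|->]; first by rewrite mulfVK.
    by rewrite mulfK.
  set l := (X in X = _ <-> _); set d := (X in _ <-> X = 0).
  have ld : l - w.2 * cross u v = - d by rewrite /l /d /cross; ring.
  split => [/eqP|d0]; first by rewrite -subr_eq0 ld oppr_eq0 => /eqP.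
  by apply/eqP; rewrite -subr_eq0 ld d0 oppr0.
rewrite -vw; split => [[p [pu pv pw]]|h].
  by rewrite -(cramerP uv0 pu pv).
by exists (cramer u v); split => //; [exact: cramer_l | exact: cramer_r].
Qed.

Lemma forms_triangle_locus u v w :
  proper_coef u -> proper_coef v -> proper_coef w ->
  forms_triangle (locus u) (locus v) (locus w) <-> tri u v w.
Proof.
move=> pu pv pw; split.
  case; rewrite !parallel_locus // => /eqP uv /eqP vw /eqP uw.
  by rewrite concurrent_locus // => /eqP c; rewrite /tri uv vw uw c.
case/and4P => uv vw uw c.
by split; rewrite ?parallel_locus ?concurrent_locus //; apply/eqP.
Qed.

Lemma triangle_area_locus u v w : tri u v w ->
  triangle_area (locus u) (locus v) (locus w) = area3 u v w.
Proof.
case/and4P => uv vw uw _; rewrite /triangle_area !meeting_point_locus //.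
rewrite /area /area3 /cramer /=.
have -> : ((u.2 * w.1.2 - w.2 * u.1.2) / cross u w -
   (v.2 * w.1.2 - w.2 * v.1.2) / cross v w) *
  ((u.1.1 * v.2 - v.1.1 * u.2) / cross u v -
   (v.1.1 * w.2 - w.1.1 * v.2) / cross v w) -
  ((u.2 * v.1.2 - v.2 * u.1.2) / cross u v -
   (v.2 * w.1.2 - w.2 * v.1.2) / cross v w) *
  ((u.1.1 * w.2 - w.1.1 * u.2) / cross u w -
   (v.1.1 * w.2 - w.1.1 * v.2) / cross v w) =
   - det3 u v w ^+ 2 / (cross u v * cross v w * cross u w).
  move: uv vw uw; rewrite /det3 /cross => uv vw uw; field.
  by rewrite uv vw uw.
rewrite mulNr normrN normrM normfV normrX real_normK ?num_real //.
by rewrite invfM [2^-1 * _]mulrC mulrA.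
Qed.

Lemma cross_sym u v : cross u v = - cross v u.
Proof. by rewrite /cross; ring. Qed.

Lemma det3_swap12 u v w : det3 v u w = - det3 u v w.
Proof. by rewrite /det3 /cross; ring. Qed.

Lemma det3_swap23 u v w : det3 u w v = - det3 u v w.
Proof. by rewrite /det3 /cross; ring. Qed.

Lemma tri_swap12 u v w : tri v u w = tri u v w.
Proof.
rewrite /tri det3_swap12 (cross_sym v u) !oppr_eq0.
by congr (_ && _); rewrite andbCA.
Qed.

Lemma tri_swap23 u v w : tri u w v = tri u v w.
Proof.
rewrite /tri det3_swap23 (cross_sym w v) !oppr_eq0.
by rewrite !andbA; congr (_ && _); rewrite andbC [X in _ && X]andbC andbA.
Qed.

Lemma area3_swap12 u v w : area3 v u w = area3 u v w.
Proof.
rewrite /area3 det3_swap12 (cross_sym v u) sqrrN !mulNr normrN.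
by congr (_ / (2 * `|_|)); ring.
Qed.

Lemma area3_swap23 u v w : area3 u w v = area3 u v w.
Proof.
rewrite /area3 det3_swap23 (cross_sym w v) sqrrN mulrN mulNr normrN.
by congr (_ / (2 * `|_|)); ring.
Qed.

Lemma arrangement_coef n (L : 'I_n -> set (R * R)) : arrangement L ->
  exists u : 'I_n -> R * R * R,
    (forall i, proper_coef (u i)) /\ forall i, L i = locus (u i).
Proof.
case=> _ lL.
have h i : exists u : R * R * R, proper_coef u /\ L i = locus u.
  by have [a [b [c [ab ->]]]] := lL i; exists (a, b, c); split => //; apply/eqP.
have [u hu] := choice h.
by exists u; split => i; case: (hu i).
Qed.

Lemma is_line_locus u : proper_coef u -> is_line (locus u).
Proof. by case: u => [[a b] c] /eqP; exists a, b, c. Qed.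

End Coordinates.

(** * Tight graphs on parabolas *)

Section ParabolaGraph.
Variables (R : realFieldType) (V : finType) (x k : V -> R).
Variables (W : {set V}) (E : {set V * V}).

Hypothesis sep : {in W &, forall i j, k i != k j ->
  (x i - x j) ^+ 2 <= `|k i - k j|}.
Hypothesis inj : {in W &, forall i j, x i = x j -> k i = k j -> i = j}.
Hypothesis EW : forall i j, (i, j) \in E -> (i \in W) && (j \in W).
Hypothesis Elt : forall i j, (i, j) \in E -> x i < x j.
Hypothesis Etight : forall i j, (i, j) \in E -> k i - k j = (x i - x j) ^+ 2.

Let sep_gt i j : i \in W -> j \in W -> k j < k i ->
  (x i - x j) ^+ 2 <= k i - k j.
Proof.
move=> iW jW kji; have := sep iW jW; rewrite gt_eqF // => /(_ isT).
by rewrite gtr0_norm ?subr_gt0.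
Qed.

(** Consecutive edges of lengths a and b would leave a gap of a^2 + b^2 in [k] between their extreme
    ends, less than the (a + b)^2 that [sep] requires. *)
Let E_no_path i j l : (i, j) \in E -> (j, l) \in E -> False.
Proof.
move=> ij jl; have /andP[iW _] := EW ij; have /andP[_ lW] := EW jl.
have [xij xjl] := (Elt ij, Elt jl); have [kij kjl] := (Etight ij, Etight jl).
have := sep_gt iW lW; nra.
Qed.

Let longest_r i j := [forall l, ((i, l) \in E) ==> (x l <= x j)].
Let longest_l i j := [forall l, ((l, j) \in E) ==> (x i <= x l)].

(** Otherwise there are longer edges [(i, l)] and [(h, j)]. If a, b, c are the successive gaps of
    [x] along h, i, j, l, then k h - k l = (a + b + c)^2 - 2ac, too small for [sep]. *)
Let E_longest i j : (i, j) \in E -> longest_r i j || longest_l i j.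
Proof.
move=> ij; apply/orP; have [|/forallPn[l]] := boolP (longest_r i j); first by left.
rewrite negb_imply -ltNge => /andP[il xjl]; right; apply/forallP => h.
apply/implyP => hj; rewrite leNgt; apply/negP => xhi.
have /andP[hW _] := EW hj; have /andP[_ lW] := EW il.
have [xij xil xhj] := And3 (Elt ij) (Elt il) (Elt hj).
have [kij kil khj] := And3 (Etight ij) (Etight il) (Etight hj).
have := sep_gt hW lW; nra.
Qed.

(** Charges each edge to an end at which it is longest, preferably the left one. *)
Let end_of (e : V * V) := if longest_r e.1 e.2 then e.1 else e.2.

Let E_eq_r i j l : (i, j) \in E -> (i, l) \in E -> x j = x l -> j = l.
Proof.
move=> ij il xjl; have /andP[_ jW] := EW ij; have /andP[_ lW] := EW il.
by apply: inj => //; have := Etight ij; rewrite xjl -(Etight il) => /addrI/oppr_inj.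
Qed.

Let E_eq_l i j l : (i, l) \in E -> (j, l) \in E -> x i = x j -> i = j.
Proof.
move=> il jl xij; have /andP[iW _] := EW il; have /andP[jW _] := EW jl.
by apply: inj => //; have := Etight il; rewrite xij -(Etight jl) => /addIr.
Qed.

(** By [E_no_path], two edges charged to one vertex have it both as left end or both as right end.
    Being longest there, they have equal length, and their other ends agree by [inj]. *)
Let end_of_inj : {in E &, injective end_of}.
Proof.
move=> [i j] [i' j'] ij ij'; rewrite /end_of /=.
case: ifP => r; case: ifP => r' e; subst.
- congr (_, _); apply: (E_eq_r ij ij'); apply/eqP; rewrite eq_le.
  by rewrite (implyP (forallP r' j) ij) (implyP (forallP r j') ij').
- by case: (E_no_path ij' ij).
- by case: (E_no_path ij ij').
- have := E_longest ij; rewrite r => /= l; have := E_longest ij'; rewrite r' => /= l'.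
  congr (_, _); apply: (E_eq_l ij ij'); apply/eqP; rewrite eq_le.
  by rewrite (implyP (forallP l i') ij') (implyP (forallP l' i) ij).
Qed.

(* Every edge is the longest one at its left end or at its right end, and the
   longest edge of all is so at both ends. *)
Lemma card_parabola_graph : (#|E| <= #|W|.-1)%N.
Proof.
have [->|[e0 e0E]] := set_0Vmem E; first by rewrite cards0.
pose len (e : V * V) := x e.2 - x e.1.
case: (@Order.TotalTheory.arg_maxP _ _ _ e0 (mem E) len e0E) => -[i j] /= ij mx.
have /andP[iW jW] := EW ij.
have rij : longest_r i j.
  apply/forallP => l; apply/implyP => il.
  by have := mx _ il; rewrite /len /= lerD2r.
rewrite -(card_in_imset end_of_inj).
(* The right end [j] of a longest edge receives no charge: an edge charged to it would have it as
   right end and equal [(i, j)], which is charged to [i]. *)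
have -> : (#|W|.-1 = #|W :\ j|)%N by rewrite (cardsD1 j) jW.
apply: subset_leq_card; apply/fintype.subsetP => v /imsetP[[i' j'] ij' ->].
have /andP[iW' jW'] := EW ij'; rewrite /end_of /= !inE.
case: ifP => r'; rewrite ?iW' ?jW' andbT; apply/eqP => ej; subst.
  exact: (E_no_path ij ij').
have := E_longest ij'; rewrite r' => /= /forallP/(_ i)/implyP/(_ ij) le1.
have := mx _ ij'; rewrite /len /= lerD2l lerN2 => le2.
have ei : i = i' by apply: (E_eq_l ij ij'); apply/eqP; rewrite eq_le le1 le2.
by move: r'; rewrite -ei rij.
Qed.

End ParabolaGraph.

(** * Triples of lines seen from one line *)

Section TripleCounting.
Local Open Scope nat_scope.

(** Adding the sum to its transpose meets each related pair exactly once in each order. Used below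
    to pass from the order of indices to the order of traces. *)
Lemma sum_orientation (V : finType) (Q r : rel V) : symmetric Q ->
  (forall i j, Q i j -> r j i = ~~ r i j) ->
  2 * (\sum_i \sum_j (r i j && Q i j)) = \sum_i \sum_j Q i j.
Proof.
move=> Qs rQ; rewrite mul2n -addnn {2}exchange_big -big_split.
apply: eq_bigr => i _; rewrite -big_split; apply: eq_bigr => j _ /=.
rewrite (Qs j i); case: (boolP (Q i j)) => [/rQ ->|]; last by rewrite !andbF.
by case: (r i j).
Qed.

(** For each line [l], the right side splits according to whether [l] is the first, second or third
    line of the sorted triple; each case contributes the left-hand sum once. *)
Lemma sum_sorted_triples n (Q : 'I_n -> 'I_n -> 'I_n -> bool) :
  (forall i j k, Q j i k = Q i j k) -> (forall i j k, Q i k j = Q i j k) ->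
  (forall j k, ~~ Q j j k) ->
  3 * (\sum_(i < n) \sum_(j < n) \sum_(k < n) ((i < j) && (j < k) && Q i j k)) =
  \sum_(l < n) \sum_(i < n) \sum_(j < n) ((i < j) && Q l i j).
Proof.
move=> s12 s23 irr; set S := (X in 3 * X).
have irr' j k : ~~ Q j k k by rewrite s12 s23 irr.
have irr'' j k : ~~ Q j k j by rewrite s23 irr.
transitivity (S + S + S); first by lia.
have S2 : S = \sum_(l < n) \sum_(i < n) \sum_(j < n) ((i < l) && (l < j) && Q l i j).
  by rewrite [RHS]exchange_big; do 3!(apply: eq_bigr => ? _); rewrite s12.
have S3 : S = \sum_(l < n) \sum_(i < n) \sum_(j < n) ((i < j) && (j < l) && Q l i j).
  rewrite [RHS]exchange_big; apply: eq_bigr => i _.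
  rewrite [RHS]exchange_big; do 2!(apply: eq_bigr => ? _).
  by rewrite [in RHS]s12 [in RHS]s23.
rewrite {2}S2 {2}S3 -2!big_split; apply: eq_bigr => l _; rewrite -2!big_split.
apply: eq_bigr => i _; rewrite -2!big_split; apply: eq_bigr => j _ /=.
case: (boolP (Q l i j)) => [q|]; last by rewrite !andbF.
have li : (l : nat) != i by apply/eqP => /val_inj e; move: q (irr i j); rewrite e => ->.
have lj : (l : nat) != j by apply/eqP => /val_inj e; move: q (irr'' j i); rewrite e => ->.
have ij : (i : nat) != j by apply/eqP => /val_inj e; move: q (irr' l j); rewrite e => ->.
rewrite !andbT.
by case: (ltngtP l i) li => // ? _; case: (ltngtP l j) lj => // ? _;
  case: (ltngtP i j) ij => // ? _ //=; lia.
Qed.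

End TripleCounting.

(** * Coordinates adapted to one line *)

Section Frame.
Variable R : realType.
Implicit Types (u v w l : R * R * R).

(* In the orthogonal frame with origin the foot of the origin on [l], first
   axis along [l] and second axis along its normal, the line [u] consists of
   the points of coordinates [(frame_x l u - frame_k l u * t, t)]. *)
Definition normsq l : R := l.1.1 ^+ 2 + l.1.2 ^+ 2.
Definition dotn l u : R := l.1.1 * u.1.1 + l.1.2 * u.1.2.
Definition frame_x l u : R := (u.2 - l.2 * dotn l u / normsq l) / cross l u.
Definition frame_k l u : R := dotn l u / cross l u.
Definition frame_pt l (s t : R) : R * R :=
  (l.2 * l.1.1 / normsq l - s * l.1.2 + t * l.1.1,
   l.2 * l.1.2 / normsq l + s * l.1.1 + t * l.1.2).

Lemma locus_frame_pt l u t : proper_coef l -> cross l u != 0 ->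
  locus u (frame_pt l (frame_x l u - frame_k l u * t) t).
Proof.
move=> /proper_norm /lt0r_neq0; rewrite /locus /frame_pt /frame_x /frame_k /=.
by rewrite /normsq /dotn /cross => N0 d0; field; rewrite N0 d0.
Qed.

Lemma locus_frame_base l s : proper_coef l -> locus l (frame_pt l s 0).
Proof.
move=> /proper_norm /lt0r_neq0; rewrite /locus /frame_pt /= /normsq => N0.
by field; rewrite N0.
Qed.

Lemma frame_det l u v : proper_coef l -> cross l u != 0 -> cross l v != 0 ->
  det3 l u v = cross l u * cross l v * (frame_x l v - frame_x l u).
Proof.
move=> /proper_norm /lt0r_neq0 N0 u0 v0; rewrite /det3 /frame_x.
move: N0 u0 v0; rewrite -/(normsq l) /normsq /dotn /cross => N0 u0 v0; field.
by rewrite N0 u0 v0.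
Qed.

Lemma frame_cross l u v : proper_coef l -> cross l u != 0 -> cross l v != 0 ->
  cross u v = cross l u * cross l v * (frame_k l u - frame_k l v) / normsq l.
Proof.
move=> /proper_norm /lt0r_neq0 N0 u0 v0; rewrite /frame_k.
move: N0 u0 v0; rewrite -/(normsq l) /normsq /dotn /cross => N0 u0 v0; field.
by rewrite N0 u0 v0.
Qed.

Lemma frame_cross_eq0 l u v : proper_coef l -> cross l u != 0 ->
  cross l v != 0 -> (cross u v == 0) = (frame_k l u == frame_k l v).
Proof.
move=> pl u0 v0; rewrite (frame_cross pl u0 v0) mulf_eq0 invr_eq0.
rewrite (gt_eqF (proper_norm pl)) orbF !mulf_eq0 (negPf u0) (negPf v0) /=.
by rewrite subr_eq0.
Qed.

Lemma frame_det_eq0 l u v : proper_coef l -> cross l u != 0 ->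
  cross l v != 0 -> (det3 l u v == 0) = (frame_x l u == frame_x l v).
Proof.
move=> pl u0 v0; rewrite (frame_det pl u0 v0) !mulf_eq0 (negPf u0) (negPf v0).
by rewrite /= subr_eq0 eq_sym.
Qed.

(** The unit square of the frame has area [normsq l]; the triangle has base |dx| on [l] and height
    |dx| / |dk|. *)
Lemma frame_area l u v : proper_coef l -> cross l u != 0 -> cross l v != 0 ->
  cross u v != 0 -> area3 l u v = normsq l / 2 *
    ((frame_x l u - frame_x l v) ^+ 2 / `|frame_k l u - frame_k l v|).
Proof.
move=> pl u0 v0 uv0; have N0 := proper_norm pl; rewrite -/(normsq l) in N0.
have k0 : `|frame_k l u - frame_k l v| != 0.
  by rewrite normr_eq0 subr_eq0 -(frame_cross_eq0 pl u0 v0).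
rewrite /area3 (frame_det pl u0 v0) (frame_cross pl u0 v0).
set d := cross l u; set d' := cross l v.
have -> : d * (d * d' * (frame_k l u - frame_k l v) / normsq l) * d' =
  (d * d') ^+ 2 * (frame_k l u - frame_k l v) / normsq l by ring.
have q0 : 0 < (d * d') ^+ 2 by rewrite exprn_even_gt0 //= mulf_neq0.
rewrite exprMn; move: ((d * d') ^+ 2) q0 => q q0.
rewrite !normrM normfV (gtr0_norm q0) (gtr0_norm N0).
by field; rewrite (lt0r_neq0 N0) (lt0r_neq0 q0) k0.
Qed.

Lemma frame_inj l u v : proper_coef l -> proper_coef u -> proper_coef v ->
  cross l u != 0 -> cross l v != 0 ->
  frame_x l u = frame_x l v -> frame_k l u = frame_k l v -> locus u = locus v.
Proof.
move=> pl pu pv u0 v0 xe /eqP; rewrite -frame_cross_eq0 // => /eqP uv0.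
have [//|E] := (parallel_locus pu pv).2 uv0.
have : (locus u `&` locus v)%classic (frame_pt l (frame_x l u) 0).
  split; first by have := locus_frame_pt 0 pl u0; rewrite mulr0 subr0.
  by have := locus_frame_pt 0 pl v0; rewrite mulr0 subr0 -xe.
by rewrite E.
Qed.

Definition sqn (p : R * R) : R := p.1 ^+ 2 + p.2 ^+ 2.

(* If the common point of [l] and [u] is a farthest vertex from the origin,
   then the other vertices on [u] lie in a chord starting at it, hence on one
   side of [l]. *)
Lemma farthest_one_side l u v w : proper_coef l -> cross l u != 0 ->
  cross l v != 0 -> cross l w != 0 -> cross u v != 0 -> cross u w != 0 ->
  sqn (cramer u v) <= sqn (cramer l u) -> sqn (cramer u w) <= sqn (cramer l u) ->
  (frame_x l u - frame_x l v) * (frame_k l u - frame_k l v) < 0 ->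
  0 < (frame_x l u - frame_x l w) * (frame_k l u - frame_k l w) -> False.
Proof.
move=> pl u0 v0 w0 uv uw fv fw sv sw.
(* The second coordinate, in the frame of [l], of the common point of [u] and [z]. *)
pose ht z := (frame_x l u - frame_x l z) / (frame_k l u - frame_k l z).
have base : cramer l u = frame_pt l (frame_x l u) 0.
  symmetry; apply: cramerP => //; first exact: locus_frame_base.
  by have := locus_frame_pt 0 pl u0; rewrite mulr0 subr0.
have vert z : cross l z != 0 -> cross u z != 0 ->
    cramer u z = frame_pt l (frame_x l u - frame_k l u * ht z) (ht z).
  move=> z0 uz; symmetry; apply: cramerP => //; first exact: locus_frame_pt.
  have := locus_frame_pt (ht z) pl z0.
  suff -> : frame_x l z - frame_k l z * ht z =
    frame_x l u - frame_k l u * ht z by [].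
  have : frame_k l u - frame_k l z != 0.
    by rewrite subr_eq0 -frame_cross_eq0.
  by rewrite /ht => ?; field.
have sgn z : 0 < (frame_k l u - frame_k l z) ^+ 2 ->
  ht z = (frame_x l u - frame_x l z) * (frame_k l u - frame_k l z) /
   (frame_k l u - frame_k l z) ^+ 2.
  by rewrite exprn_even_gt0 //= => ?; rewrite /ht; field.
have k2 z : cross l z != 0 -> cross u z != 0 ->
    0 < (frame_k l u - frame_k l z) ^+ 2.
  by move=> ? ?; rewrite exprn_even_gt0 //= subr_eq0 -frame_cross_eq0.
have hv : ht v < 0 by rewrite sgn ?k2 // pmulr_llt0 ?invr_gt0 ?k2.
have hw : 0 < ht w by rewrite sgn ?k2 // pmulr_lgt0 ?invr_gt0 ?k2.
move: fv fw; rewrite base !vert // /sqn /frame_pt /=.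
move: (ht v) (ht w) hv hw (proper_norm pl) => s t s0 t0.
move: (l.2 * l.1.1 / _) (l.2 * l.1.2 / _) (frame_x _ _) (frame_k _ _).
move: (l.1.1) (l.1.2) => a b p q X k N0.
(* Along [u], the squared distance to the origin at height z exceeds that at height 0 by z (e + z
   g), with g > 0. This cannot be nonpositive at heights of both signs. *)
set e := 2 * (p - X * b) * (k * b + a) + 2 * (q + X * a) * (b - k * a).
set g := (k * b + a) ^+ 2 + (b - k * a) ^+ 2.
have g0 : 0 < g.
  have -> : g = (1 + k ^+ 2) * (a ^+ 2 + b ^+ 2) by rewrite /g; ring.
  by rewrite mulr_gt0 // ltr_pwDl ?sqr_ge0.
have ex z : (p - (X - k * z) * b + z * a) ^+ 2 +
    (q + (X - k * z) * a + z * b) ^+ 2 =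
   ((p - X * b + 0 * a) ^+ 2 + (q + X * a + 0 * b) ^+ 2) + z * (e + z * g).
  by rewrite /e /g; ring.
rewrite !ex !gerDl (nmulr_rle0 _ s0) (pmulr_rle0 _ t0) => h1 h2.
by nra.
Qed.

End Frame.

(** * Upper bound *)

Lemma card_pair_mem (V W : finType) (A : mem_pred (V * W)) :
  fintype.card A = (\sum_i \sum_j in_mem (i, j) A)%N.
Proof.
case: A => p; have -> : fintype.card (Mem p) = #|p| by [].
rewrite pair_bigA -sum1_card big_mkcond.
by apply: eq_bigr => -[i j] _ /=; rewrite unfold_in; case: (p _).
Qed.

Section UpperBound.
Variables (R : realType) (n : nat) (u : 'I_n -> R * R * R) (T : R).
Hypothesis pu : forall i, proper_coef (u i).
Hypothesis inju : forall i j, locus (u i) = locus (u j) -> i = j.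
Hypothesis T0 : 0 < T.
Hypothesis maxT : forall i j k, tri (u i) (u j) (u k) ->
  area3 (u i) (u j) (u k) <= T.

Definition max_tri i j k : bool :=
  tri (u i) (u j) (u k) && (area3 (u i) (u j) (u k) == T).

Lemma max_tri_swap12 i j k : max_tri j i k = max_tri i j k.
Proof. by rewrite /max_tri tri_swap12 area3_swap12. Qed.

Lemma max_tri_swap23 i j k : max_tri i k j = max_tri i j k.
Proof. by rewrite /max_tri tri_swap23 area3_swap23. Qed.

Lemma max_tri_irr j k : ~~ max_tri j j k.
Proof. by rewrite /max_tri /tri /cross subrr eqxx. Qed.

Section AroundLine.
Variable l : 'I_n.

Let x i := frame_x (u l) (u i).
(** The factor is chosen so that area [T] corresponds to dx^2 = |dk|. *)
Let k i := 2 * T / normsq (u l) * frame_k (u l) (u i).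
Let c0 : 0 < 2 * T / normsq (u l).
Proof. by rewrite divr_gt0 ?mulr_gt0 //; exact: proper_norm. Qed.

Definition transversal_to : {set 'I_n} := [set i | cross (u l) (u i) != 0].

Lemma area3_tight i j : cross (u l) (u i) != 0 -> cross (u l) (u j) != 0 ->
  cross (u i) (u j) != 0 ->
  area3 (u l) (u i) (u j) = T * ((x i - x j) ^+ 2 / `|k i - k j|).
Proof.
move=> i0 j0 ij0; rewrite (frame_area (pu l) i0 j0 ij0) -/(x i) -/(x j).
rewrite /k -mulrBr normrM (gtr0_norm c0).
have N0 : normsq (u l) != 0 by apply/lt0r_neq0/proper_norm.
have k0 : `|frame_k (u l) (u i) - frame_k (u l) (u j)| != 0.
  by rewrite normr_eq0 subr_eq0 -frame_cross_eq0.
by field; rewrite N0 k0 (lt0r_neq0 T0).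
Qed.

Lemma frame_k_eq i j : cross (u l) (u i) != 0 -> cross (u l) (u j) != 0 ->
  (cross (u i) (u j) == 0) = (k i == k j).
Proof.
move=> i0 j0; rewrite (frame_cross_eq0 (pu l)) // /k.
by rewrite (inj_eq (mulfI (lt0r_neq0 c0))).
Qed.

Lemma frame_sep : {in transversal_to &, forall i j, k i != k j ->
  (x i - x j) ^+ 2 <= `|k i - k j|}.
Proof.
move=> i j; rewrite !inE => i0 j0 kij.
have [xij|xij] := eqVneq (x i) (x j).
  by rewrite xij subrr expr0n /= normr_ge0.
have ij0 : cross (u i) (u j) != 0 by rewrite frame_k_eq.
have : area3 (u l) (u i) (u j) <= T.
  by apply: maxT; rewrite /tri i0 ij0 j0 frame_det_eq0.
rewrite area3_tight // ger_pMr // ler_pdivrMr ?mul1r //.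
by rewrite normr_gt0 subr_eq0.
Qed.

Lemma frame_pt_inj : {in transversal_to &, forall i j,
  x i = x j -> k i = k j -> i = j}.
Proof.
move=> i j; rewrite !inE => i0 j0 xij kij; apply: inju.
apply: (frame_inj (pu l) (pu i) (pu j) i0 j0 xij).
exact: (mulfI (lt0r_neq0 c0)).
Qed.

Lemma max_triP i j : max_tri l i j ->
  [/\ i \in transversal_to, j \in transversal_to, x i != x j, k i != k j
    & `|k i - k j| = (x i - x j) ^+ 2].
Proof.
case/andP => /and4P[i0 ij0 j0 d0] /eqP.
have kij : k i != k j by rewrite -frame_k_eq.
rewrite !inE area3_tight // => e; split => //; first by rewrite -frame_det_eq0.
have kn : `|k i - k j| != 0 by rewrite normr_eq0 subr_eq0.
have : (x i - x j) ^+ 2 / `|k i - k j| = 1.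
  by apply: (mulfI (lt0r_neq0 T0)); rewrite e mulr1.
by move=> /(congr1 ( *%R^~ `|k i - k j|)); rewrite mulfVK // mul1r.
Qed.

(** The sign of dx / dk tells on which side of [l] the third vertex lies, so the two sets separate
    the triangles by side, each edge being directed by increasing trace. *)
Definition edges_above : {set 'I_n * 'I_n} :=
  [set e | [&& max_tri l e.1 e.2, x e.1 < x e.2 & k e.2 < k e.1]].
Definition edges_below : {set 'I_n * 'I_n} :=
  [set e | [&& max_tri l e.1 e.2, x e.1 < x e.2 & k e.1 < k e.2]].

Lemma card_edges_above (W : {set 'I_n}) : W \subset transversal_to ->
  (forall i j, (i, j) \in edges_above -> (i \in W) && (j \in W)) ->
  (#|edges_above| <= #|W|.-1)%N.
Proof.
move=> /fintype.subsetP sW EW; apply: (@card_parabola_graph _ _ x k) => //.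
- by move=> i j /sW iW /sW jW; exact: frame_sep.
- by move=> i j /sW iW /sW jW; exact: frame_pt_inj.
- by move=> i j; rewrite inE => /and3P[].
- move=> i j; rewrite inE => /and3P[/max_triP[_ _ _ _ <-] _ /= kij].
  by rewrite gtr0_norm // subr_gt0.
Qed.

Lemma card_edges_below (W : {set 'I_n}) : W \subset transversal_to ->
  (forall i j, (i, j) \in edges_below -> (i \in W) && (j \in W)) ->
  (#|edges_below| <= #|W|.-1)%N.
Proof.
(* Reflection in [l] changes the sign of [k] and exchanges the two sides. *)
move=> /fintype.subsetP sW EW; apply: (@card_parabola_graph _ _ x (fun i => - k i)) => //.
- move=> i j /sW iW /sW jW; rewrite eqr_opp -opprD normrN; exact: frame_sep.
- by move=> i j /sW iW /sW jW xij /oppr_inj; exact: frame_pt_inj.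
- by move=> i j; rewrite inE => /and3P[].
- move=> i j; rewrite inE => /and3P[/max_triP[_ _ _ _ <-] _ /= kij].
  by rewrite ltr0_norm ?subr_lt0 // opprB opprK addrC.
Qed.

(** Orienting pairs by trace instead of index keeps the count; the sign of dk then distributes them
    over the two sides. *)
Lemma sum_max_tri_edges :
  (\sum_(i < n) \sum_(j < n) ((i < j) && max_tri l i j) =
    #|edges_above| + #|edges_below|)%N.
Proof.
apply/eqP; rewrite -(@eqn_pmul2l 2) //; apply/eqP.
have Qs : symmetric (max_tri l) by move=> i j; rewrite max_tri_swap23.
rewrite (sum_orientation Qs); last first.
  move=> i j /max_triP[_ _ xij _ _].
  have : (i : nat) != j by apply: contraNneq xij => /val_inj ->.
  by lia.
rewrite -(@sum_orientation _ _ (fun i j => x i < x j) Qs); last first.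
  move=> i j /max_triP[_ _ xij _ _]; rewrite -leNgt le_eqVlt eq_sym.
  by rewrite (negPf xij).
congr (_ * _)%N.
rewrite !card_pair_mem.
rewrite -big_split; apply: eq_bigr => i _ /=; rewrite -big_split.
apply: eq_bigr => j _ /=; rewrite !inE /=.
case: (boolP (max_tri l i j)) => [/max_triP[_ _ _ kij _]|]; last by rewrite !andbF.
by rewrite andbT; case: (x i < x j) => //=; case: ltgtP kij.
Qed.

Lemma card_transversal_to : (#|transversal_to| <= n.-1)%N.
Proof.
have -> : n.-1 = #|[set~ l]| by rewrite cardsC1 card_ord.
apply: subset_leq_card; apply/fintype.subsetP => i; rewrite !inE; apply: contraNneq => ->.
by rewrite /cross subrr.
Qed.

Lemma edges_above_transversal i j : (i, j) \in edges_above ->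
  (i \in transversal_to) && (j \in transversal_to).
Proof. by rewrite inE => /and3P[/max_triP[-> ->]]. Qed.

Lemma edges_below_transversal i j : (i, j) \in edges_below ->
  (i \in transversal_to) && (j \in transversal_to).
Proof. by rewrite inE => /and3P[/max_triP[-> ->]]. Qed.

Lemma card_edges_above_le : (#|edges_above| <= n.-2)%N.
Proof.
apply: leq_trans (card_edges_above (subxx _) edges_above_transversal) _.
by have := card_transversal_to; lia.
Qed.

Lemma card_edges_below_le : (#|edges_below| <= n.-2)%N.
Proof.
apply: leq_trans (card_edges_below (subxx _) edges_below_transversal) _.
by have := card_transversal_to; lia.
Qed.

(** By [farthest_one_side], [b] cannot have neighbours in both graphs. In the graph where it is
    isolated, it can be removed from the vertex set, which saves one edge. *)
Lemma card_edges_farthest b : (2 < n)%N -> b \in transversal_to ->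
  (forall i j, cross (u i) (u j) != 0 ->
     sqn (cramer (u i) (u j)) <= sqn (cramer (u l) (u b))) ->
  (#|edges_above| + #|edges_below| < 2 * n.-2)%N.
Proof.
move=> n2 bl far; have b0 : cross (u l) (u b) != 0 by rewrite inE in bl.
have [/existsP[v /andP[mv sv]]|nv] := boolP [exists v,
    max_tri l b v && ((x b - x v) * (k b - k v) < 0)]; last first.
  have : (#|edges_above| <= #|transversal_to :\ b|.-1)%N.
    apply: card_edges_above => [|i j ij]; first exact: subD1set.
    have /andP[it jt] := edges_above_transversal ij; rewrite !inE.
    move: it jt; rewrite !inE => -> ->; rewrite !andbT.
    move: ij; rewrite inE /= => /and3P[m xij kij].
    apply/andP; split; apply: contraNneq nv => e; apply/existsP.
      by exists j; rewrite -e m nmulr_rlt0 ?subr_gt0 ?subr_lt0.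
    by exists i; rewrite -e max_tri_swap23 m pmulr_rlt0 ?subr_gt0 ?subr_lt0.
  have := cardsD1 b transversal_to; rewrite bl.
  by have := card_transversal_to; have := card_edges_below_le; lia.
have [/existsP[w /andP[mw sw]]|nw] := boolP [exists w,
    max_tri l b w && (0 < (x b - x w) * (k b - k w))]; last first.
  have : (#|edges_below| <= #|transversal_to :\ b|.-1)%N.
    apply: card_edges_below => [|i j ij]; first exact: subD1set.
    have /andP[it jt] := edges_below_transversal ij; rewrite !inE.
    move: it jt; rewrite !inE => -> ->; rewrite !andbT.
    move: ij; rewrite inE /= => /and3P[m xij kij].
    apply/andP; split; apply: contraNneq nw => e; apply/existsP.
      by exists j; rewrite -e m nmulr_rgt0 ?subr_gt0 ?subr_lt0.
    by exists i; rewrite -e max_tri_swap23 m pmulr_rgt0 ?subr_gt0 ?subr_lt0.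
  have := cardsD1 b transversal_to; rewrite bl.
  by have := card_transversal_to; have := card_edges_above_le; lia.
case/andP: mv => /and4P[_ bv v0 _] _; case/andP: mw => /and4P[_ bw w0 _] _.
exfalso; apply: (farthest_one_side (pu l) b0 v0 w0 bv bw (far _ _ bv) (far _ _ bw)).
  by move: sv; rewrite /k -mulrBr mulrCA pmulr_rlt0.
by move: sw; rewrite /k -mulrBr mulrCA pmulr_rgt0.
Qed.

End AroundLine.

Lemma max_tri_bound : (2 < n)%N -> (exists i j k, max_tri i j k) ->
  (3 * (\sum_(i < n) \sum_(j < n) \sum_(k < n)
          ((i < j) && (j < k) && max_tri i j k)) < 2 * n * n.-2)%N.
Proof.
move=> n2 [i0 [j0 [k0 m0]]].
rewrite (sum_sorted_triples max_tri_swap12 max_tri_swap23 max_tri_irr).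
have c0 : cross (u i0) (u j0) != 0 by case/andP: m0 => /and4P[].
pose P (e : 'I_n * 'I_n) := cross (u e.1) (u e.2) != 0.
pose F (e : 'I_n * 'I_n) := sqn (cramer (u e.1) (u e.2)).
(* The lines [l] and [b] meet at a vertex farthest from the origin; [l] alone provides the strict
   inequality. *)
case: (@Order.TotalTheory.arg_maxP _ _ _ (i0, j0) P F c0) => -[l b] lb far.
under eq_bigr => i _ do rewrite sum_max_tri_edges.
rewrite (bigD1 l) //=.
have lt : (#|edges_above l| + #|edges_below l| < 2 * n.-2)%N.
  apply: (@card_edges_farthest l b) => //; first by rewrite inE.
  by move=> i j ij; exact: (far (i, j) ij).
have le : (\sum_(i < n | i != l) (#|edges_above i| + #|edges_below i|) <=
           n.-1 * (2 * n.-2))%N.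
  have -> : (n.-1 * (2 * n.-2) = \sum_(i < n | i != l) (2 * n.-2))%N.
    rewrite sum_nat_const; congr (_ * _)%N.
    have -> : n.-1 = #|[set~ l]| by rewrite cardsC1 card_ord.
    by apply: eq_card => i; rewrite !inE.
  apply: leq_sum => i _; have := card_edges_above_le i.
  by have := card_edges_below_le i; lia.
have -> : (2 * n * n.-2 = 2 * n.-2 + n.-1 * (2 * n.-2))%N.
  by rewrite -{1}(prednK (ltnW (ltnW n2))); ring.
by rewrite -addSn leq_add.
Qed.

End UpperBound.

Lemma nb_max_area_sum (R : realType) n (L : 'I_n -> set (R * R))
    (Q : 'I_n -> 'I_n -> 'I_n -> bool) :
  (forall i j k, `[< max_area_triangle L (i, j, k) >] =
     [&& (i < j)%N, (j < k)%N & Q i j k]) ->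
  nb_max_area L =
    (\sum_(i < n) \sum_(j < n) \sum_(k < n) ((i < j) && (j < k) && Q i j k))%N.
Proof.
move=> LQ; rewrite /nb_max_area card_pair_mem [RHS]pair_bigA.
by apply: eq_bigr => -[i j] _; apply: eq_bigr => k _; rewrite inE LQ andbA.
Qed.

Lemma nb_max_area_lt (R : realType) n (L : 'I_n -> set (R * R)) :
  (2 < n)%N -> arrangement L -> (3 * nb_max_area L < 2 * n * n.-2)%N.
Proof.
move=> n2 LA; have [u [pu Lu]] := arrangement_coef LA.
have inju i j : locus (u i) = locus (u j) -> i = j.
  by rewrite -!Lu; exact: LA.1.
have triE i j k : triangle L (i, j, k) <->
    [&& (i < j)%N, (j < k)%N & tri (u i) (u j) (u k)].
  rewrite /triangle !Lu.
  have fE := forms_triangle_locus (pu i) (pu j) (pu k).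
  by split => [[-> -> /fE]|/and3P[-> -> /fE]].
have areaE i j k : tri (u i) (u j) (u k) ->
    area_of L (i, j, k) = area3 (u i) (u j) (u k).
  by move=> t; rewrite /area_of !Lu triangle_area_locus.
have [[[[i0 j0] k0] [t0 mx]]|none] := pselect (exists t, max_area_triangle L t);
    last first.
  (* Without any triangle the count is zero, and [2 < n] makes the bound positive. *)
  have -> : nb_max_area L = 0%N.
    apply: eq_card0 => t; rewrite !inE; apply/negbTE/asboolPn => m.
    by apply: none; exists t.
  by case: (n) n2 => [|[|[|m]]] //= _; lia.
have /triE/and3P[i0j0 j0k0 tri0] := t0.
set T := area3 (u i0) (u j0) (u k0).
have T0 : 0 < T.
  case/and4P: tri0 => a b c d; rewrite /T /area3 divr_gt0 ?exprn_even_gt0 //.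
  by rewrite mulr_gt0 // normr_gt0 !mulf_neq0.
have maxS (i j k : 'I_n) : (i < j)%N -> (j < k)%N -> tri (u i) (u j) (u k) ->
    area3 (u i) (u j) (u k) <= T.
  move=> ij jk t; rewrite -areaE // /T -areaE //; apply: mx.
  by apply/triE; rewrite ij jk t.
have maxT i j k : tri (u i) (u j) (u k) -> area3 (u i) (u j) (u k) <= T.
  move=> t; have ij : (i : nat) != j.
    by apply: contraTneq t => /val_inj ->; rewrite /tri /cross subrr eqxx.
  have jk : (j : nat) != k.
    by apply: contraTneq t => /val_inj ->; rewrite /tri /cross subrr eqxx andbF.
  have ik : (i : nat) != k.
    by apply: contraTneq t => /val_inj ->; rewrite /tri /cross subrr eqxx !andbF.
  case: (ltngtP i j) ij => // ij _; case: (ltngtP j k) jk => // jk _;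
    case: (ltngtP i k) ik => // ik _; try lia.
  - exact: maxS.
  - by rewrite -area3_swap23; apply: maxS => //; rewrite tri_swap23.
  - by rewrite -area3_swap23 -area3_swap12; apply: maxS => //;
      rewrite tri_swap12 tri_swap23.
  - by rewrite -area3_swap12; apply: maxS => //; rewrite tri_swap12.
  - by rewrite -area3_swap12 -area3_swap23; apply: maxS => //;
      rewrite tri_swap23 tri_swap12.
  - by rewrite -area3_swap12 -area3_swap23 -area3_swap12; apply: maxS => //;
      rewrite tri_swap12 tri_swap23 tri_swap12.
rewrite (@nb_max_area_sum _ _ _ (max_tri u T)).
  apply: max_tri_bound => //; exists i0, j0, k0.
  by rewrite /max_tri tri0 /= eqxx.
move=> i j k; apply/asboolP/and3P.
  case=> /triE/and3P[ij jk t] m; split => //; rewrite /max_tri t /=.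
  by rewrite eq_le maxT //= /T -!areaE // m.
case=> ij jk /andP[t /eqP e]; split; first by apply/triE; rewrite ij jk t.
by move=> [[i' j'] k'] /triE/and3P[ij' jk' t']; rewrite !areaE // e maxT.
Qed.

Lemma M_lt (R : realType) n : (3 <= n)%N ->
  (M R n)%:R < 2 / 3 * n%:R * (n%:R - 2) :> R.
Proof.
move=> n3; have [L [LA <-]] := M_attained R n.
have := nb_max_area_lt n3 LA; rewrite -(ltr_nat R) !natrM.
have -> : (n.-2)%:R = n%:R - 2 :> R by rewrite -subn2 natrB //; lia.
by lra.
Qed.

(** * Lower bound *)

Section DualPoints.
Variable R : realType.
Implicit Types (p q r : R * R).

(* The point [p] encodes the line [x = p.1 + p.2 * y]. *)
Definition slanted p : R * R * R := (1, - p.2, p.1).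
Definition horizontal (y : R) : R * R * R := (0, 1, y).

(** Twice the signed area of the triangle of the dual points [p], [q], [r]. *)
Definition ddet p q r : R :=
  p.1 * (q.2 - r.2) - q.1 * (p.2 - r.2) + r.1 * (p.2 - q.2).

(* For lines bounding a triangle: its area is at most [1 / 2]. *)
Definition small3 p q r : Prop :=
  ddet p q r ^+ 2 <= `|(p.2 - q.2) * (q.2 - r.2) * (p.2 - r.2)|.

Lemma small3_swap12 p q r : small3 p q r -> small3 q p r.
Proof.
rewrite /small3; have -> : ddet q p r = - ddet p q r by rewrite /ddet; ring.
have -> : (q.2 - p.2) * (p.2 - r.2) * (q.2 - r.2) =
  - ((p.2 - q.2) * (q.2 - r.2) * (p.2 - r.2)) by ring.
by rewrite sqrrN normrN.
Qed.

Lemma small3_swap23 p q r : small3 p q r -> small3 p r q.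
Proof.
rewrite /small3; have -> : ddet p r q = - ddet p q r by rewrite /ddet; ring.
have -> : (p.2 - r.2) * (r.2 - q.2) * (p.2 - q.2) =
  - ((p.2 - q.2) * (q.2 - r.2) * (p.2 - r.2)) by ring.
by rewrite sqrrN normrN.
Qed.

(** The first condition says that the two lines, if distinct, meet at a height y between -1 and 1.
    The second one separates pairs within a family ([close_to]) from pairs across families
    ([far_from]). *)
Definition close_to p q : Prop :=
  `|p.1 - q.1| <= `|p.2 - q.2| /\ `|p.2 - q.2| <= 1 / 10.

Definition far_from p q : Prop :=
  `|p.1 - q.1| <= `|p.2 - q.2| /\ 1 / 2 <= `|p.2 - q.2|.

Lemma close_to_sym p q : close_to p q -> close_to q p.
Proof. by rewrite /close_to ![`|p.1 - _|]distrC ![`|p.2 - _|]distrC. Qed.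

Lemma far_from_sym p q : far_from p q -> far_from q p.
Proof. by rewrite /far_from ![`|p.1 - _|]distrC ![`|p.2 - _|]distrC. Qed.

Lemma ddet_norm_le p q r :
  `|ddet p q r| <= `|p.1 - q.1| * `|q.2 - r.2| + `|q.1 - r.1| * `|p.2 - q.2|.
Proof.
rewrite -!normrM; apply: le_trans _ (ler_normB _ _).
by rewrite le_eqVlt; apply/orP; left; apply/eqP; congr `|_|; rewrite /ddet; ring.
Qed.

(** With c, U, V the slope differences of pq, qr, pr, the determinant is at most 2cU, and 4cU <= V
    because c <= 1/10, V >= 1/2 and U <= c + V. *)
Lemma small3_near2 p q r : close_to p q -> far_from p r -> far_from q r -> small3 p q r.
Proof.
move=> [a1 a2] [_ b1] [c1 c2]; rewrite /small3 -(real_normK (num_real (ddet p q r))).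
have U1 : `|q.2 - r.2| <= `|p.2 - q.2| + `|p.2 - r.2|.
  by rewrite [`|p.2 - q.2|]distrC; exact: ler_distD.
have := ddet_norm_le p q r; rewrite !normrM.
move: a1 a2 b1 c1 c2 U1 (normr_ge0 (ddet p q r)) (normr_ge0 (p.1 - q.1)).
move: `|p.1 - q.1| `|p.2 - q.2| `|p.2 - r.2| `|q.2 - r.2| `|q.1 - r.1| `|ddet p q r|.
move=> x c V U y D a1 a2 b1 c1 c2 U1 D0 x0 De.
have D1 : D <= 2 * (c * U) by nra.
have cU : 0 <= c * U by nra.
have D2 : D ^+ 2 <= (2 * (c * U)) ^+ 2 by rewrite lerXn2r // nnegrE; lra.
have D3 : 0 <= V - 4 * (c * U) by nra.
have -> : c * U * V = (2 * (c * U)) ^+ 2 + c * U * (V - 4 * (c * U)) by ring.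
by rewrite (le_trans D2) // lerDl mulr_ge0.
Qed.

(** After reordering, [q] has the middle slope. Then V = c + U, the determinant is at most 2cU, and
    4cU <= c + U. *)
Lemma small3_near3 p q r : close_to p q -> close_to q r -> close_to p r -> small3 p q r.
Proof.
have mid p' q' r' : close_to p' q' -> close_to q' r' ->
    `|p'.2 - r'.2| = `|p'.2 - q'.2| + `|q'.2 - r'.2| -> small3 p' q' r'.
  move=> [a1 a2] [b1 b2] e; rewrite /small3 -(real_normK (num_real (ddet p' q' r'))).
  have := ddet_norm_le p' q' r'; rewrite !normrM e.
  move: a1 a2 b1 b2 (normr_ge0 (ddet p' q' r')) (normr_ge0 (p'.1 - q'.1)) (normr_ge0 (q'.1 - r'.1)).
  move: `|p'.1 - q'.1| `|p'.2 - q'.2| `|q'.2 - r'.2| `|q'.1 - r'.1| `|ddet p' q' r'|.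
  move=> x c U y D a1 a2 b1 b2 D0 x0 y0 De.
  have D1 : D <= 2 * c * U by nra.
  have cU : 0 <= c * U by nra.
  have D2 : D ^+ 2 <= (2 * c * U) ^+ 2 by rewrite lerXn2r // nnegrE; nra.
  have D3 : 4 * (c * U) <= c + U by nra.
  have -> : c * U * (c + U) = (2 * c * U) ^+ 2 + c * U * (c + U - 4 * (c * U)) by ring.
  by nra.
move=> pq qr pr.
have btw (a b c : R) : a <= b -> b <= c -> `|a - c| = `|a - b| + `|b - c|.
  by move=> ab bc; rewrite !ler0_norm ?subr_le0 ?(le_trans ab) //; ring.
have btw' (a b c : R) : c <= b -> b <= a -> `|a - c| = `|a - b| + `|b - c|.
  by move=> cb ba; rewrite !ger0_norm ?subr_ge0 ?(le_trans cb) //; ring.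
have [qp rq rp] := And3 (close_to_sym pq) (close_to_sym qr) (close_to_sym pr).
have [lpq|/ltW lqp] := leP p.2 q.2; have [lqr|/ltW lrq] := leP q.2 r.2.
- by apply: mid => //; exact: btw.
- have [lpr|/ltW lrp] := leP p.2 r.2.
    by apply/small3_swap23/mid => //; exact: btw.
  by apply/small3_swap12/mid => //; exact: btw'.
- have [lpr|/ltW lrp] := leP p.2 r.2.
    by apply/small3_swap12/mid => //; exact: btw.
  by apply/small3_swap23/mid => //; exact: btw'.
- by apply: mid => //; exact: btw'.
Qed.

Lemma cross_slanted p q : cross (slanted p) (slanted q) = p.2 - q.2.
Proof. by rewrite /cross /=; ring. Qed.

Lemma cross_horizontal y p : cross (horizontal y) (slanted p) = - 1.
Proof. by rewrite /cross /=; ring. Qed.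

Lemma cross_horizontals y z : cross (horizontal y) (horizontal z) = 0.
Proof. by rewrite /cross /=; ring. Qed.

Lemma det3_slanted p q r :
  det3 (slanted p) (slanted q) (slanted r) = ddet p q r.
Proof. by rewrite /det3 /cross /ddet /=; ring. Qed.

Lemma det3_horizontal y p q :
  det3 (horizontal y) (slanted p) (slanted q) =
  (p.1 + p.2 * y) - (q.1 + q.2 * y).
Proof. by rewrite /det3 /cross /=; ring. Qed.

Lemma proper_slanted p : proper_coef (slanted p).
Proof. by rewrite /proper_coef /= xpair_eqE oner_eq0. Qed.

Lemma proper_horizontal y : proper_coef (horizontal y).
Proof. by rewrite /proper_coef /= xpair_eqE oner_eq0 andbF. Qed.

Lemma area3_slanted p q r :
  tri (slanted p) (slanted q) (slanted r) -> small3 p q r ->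
  area3 (slanted p) (slanted q) (slanted r) <= 1 / 2.
Proof.
case/and4P; rewrite /area3 det3_slanted !cross_slanted => pq qr pr _ s.
rewrite ler_pdivrMr; first by move: s; rewrite /small3; lra.
by rewrite mulr_gt0 // normr_gt0 !mulf_neq0.
Qed.

Lemma area3_horizontal y p q : p.2 != q.2 ->
  area3 (horizontal y) (slanted p) (slanted q) =
  1 / 2 * (((p.1 + p.2 * y) - (q.1 + q.2 * y)) ^+ 2 / `|p.2 - q.2|).
Proof.
move=> pq; rewrite /area3 det3_horizontal cross_slanted !cross_horizontal.
have -> : -1 * (p.2 - q.2) * -1 = p.2 - q.2 by ring.
have : `|p.2 - q.2| != 0 by rewrite normr_eq0 subr_eq0.
by move=> ?; field.
Qed.

Lemma area3_horizontal_le y p q : p.2 != q.2 ->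
  ((p.1 + p.2 * y) - (q.1 + q.2 * y)) ^+ 2 <= `|p.2 - q.2| ->
  area3 (horizontal y) (slanted p) (slanted q) <= 1 / 2.
Proof.
move=> pq h; rewrite area3_horizontal // ger_pMr; last by lra.
by rewrite ler_pdivrMr ?mul1r // normr_gt0 subr_eq0.
Qed.

Lemma area3_horizontal_eq y p q : p.2 != q.2 ->
  ((p.1 + p.2 * y) - (q.1 + q.2 * y)) ^+ 2 = `|p.2 - q.2| ->
  area3 (horizontal y) (slanted p) (slanted q) = 1 / 2.
Proof.
move=> pq h; rewrite area3_horizontal // h divff ?mulr1 //.
by rewrite normr_eq0 subr_eq0.
Qed.

Lemma tri_horizontal y p q : p.2 != q.2 ->
  p.1 + p.2 * y != q.1 + q.2 * y ->
  tri (horizontal y) (slanted p) (slanted q).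
Proof.
move=> pq d; rewrite /tri cross_slanted !cross_horizontal det3_horizontal.
by rewrite !subr_eq0 oppr_eq0 oner_eq0 pq d.
Qed.

Lemma slanted_inj p q : locus (slanted p) = locus (slanted q) -> p = q.
Proof.
move=> e.
have e0 : locus (slanted q) (p.1, 0).
  by rewrite -e /locus /=; ring.
have e1 : locus (slanted q) (p.1 + p.2, 1).
  by rewrite -e /locus /=; ring.
move: p q e0 e1 {e} => [a b] [c d]; rewrite /locus /= => e0 e1.
by congr (_, _); lra.
Qed.

End DualPoints.

(** * The tangent lines and their companions *)

Section Clusters.
Variables (R : realType) (h : R).
Hypothesis h0 : 0 < h.
Hypothesis h1 : h <= 1 / 300.

(* The lines cutting out area [1 / 2] with [x = 0] and [y = 1]. *)
Definition tangent_pt (m : R) : R * R := (m - m ^+ 2, m ^+ 2).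

(* The line forming with [y = 0] triangles of area [1 / 2] both with the line
   [tangent_pt (m - h)] and with [tangent_pt (m + h)]. *)
Definition link_pt (m : R) : R * R :=
  (m - m ^+ 2 - h ^+ 2 - m / (2 * m - 1),
   m ^+ 2 + h ^+ 2 + h ^+ 2 * (2 * m - 1) ^+ 2 + (m / (2 * m - 1)) ^+ 2).

Definition in_range (m : R) : bool := (3 / 4 <= m) && (m <= 3 / 4 + 1 / 300).

Let h_sq : h ^+ 2 <= 1 / 1000.
Proof.
by have := ler_pM (ltW h0) (ltW h0) h1 h1; rewrite -expr2; lra.
Qed.

Lemma link_ratio m : in_range m ->
  3 / 2 - 1 / 75 <= m / (2 * m - 1) <= 3 / 2.
Proof.
case/andP=> m1 m2; have s0 : 0 < 2 * m - 1 by lra.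
by rewrite ler_pdivlMr // ler_pdivrMr //; apply/andP; split; lra.
Qed.

Lemma tangent_box m : in_range m ->
  let p := tangent_pt m in
  [/\ 9 / 16 <= p.2, p.2 <= 9 / 16 + 1 / 20, 3 / 16 - 1 / 100 <= p.1,
      p.1 <= 3 / 16 & (p.1 + p.2) ^+ 2 = p.2].
Proof.
case/andP=> m1 m2 p; rewrite /p /=.
by split; [nra | nra | nra | nra | ring].
Qed.

Lemma link_box m : in_range m ->
  let p := link_pt m in
  [/\ 45 / 16 - 1 / 20 <= p.2, p.2 <= 45 / 16 + 1 / 20,
      - 21 / 16 - 1 / 50 <= p.1 & p.1 <= - 21 / 16 + 1 / 50].
Proof.
move=> mr p; rewrite /p /link_pt /=; have /andP[r1 r2] := link_ratio mr.
case/andP: mr => m1 m2.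
move: (m / (2 * m - 1)) r1 r2 => r r1 r2.
have m3 : 9 / 16 <= m ^+ 2 <= 9 / 16 + 1 / 190 by apply/andP; split; nra.
have h2 : 0 <= h ^+ 2 <= 1 / 1000.
  by rewrite sqr_ge0 h_sq.
have s2 : 0 <= (2 * m - 1) ^+ 2 <= 1 by apply/andP; split; nra.
have r3 : 9 / 4 - 3 / 75 <= r ^+ 2 <= 9 / 4 by apply/andP; split; nra.
move: (m ^+ 2) (h ^+ 2) ((2 * m - 1) ^+ 2) (r ^+ 2) m3 h2 s2 r3.
move=> M H S Q /andP[? ?] /andP[? ?] /andP[? ?] /andP[? ?].
have HS : 0 <= H * S <= H by apply/andP; split; nra.
by move: HS; move: (H * S) => HS /andP[? ?]; split; lra.
Qed.

Lemma tangent_near m m' : in_range m -> in_range m' ->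
  close_to (tangent_pt m) (tangent_pt m').
Proof.
move=> r r'; split; last first.
  have [] := tangent_box r; have [] := tangent_box r'.
  by move=> *; rewrite ler_norml; apply/andP; split; lra.
case/andP: r => ? ?; case/andP: r' => ? ?; rewrite /tangent_pt /=.
have -> : m - m ^+ 2 - (m' - m' ^+ 2) = (m - m') * (1 - m - m') by ring.
have -> : m ^+ 2 - m' ^+ 2 = (m - m') * (m + m') by ring.
rewrite !normrM ler_wpM2l ?normr_ge0 // [leRHS]ger0_norm; last by lra.
by rewrite ler_norml; apply/andP; split; lra.
Qed.

(** Divided differences of the two coordinates. They are dominated by the ratio m / (2m - 1), whose
    divided difference is -q with q between 3 and 4. That |b| exceeds |a| gives [link_near]; that b
    is nonzero gives distinct slopes. *)
Lemma link_diff m m' : in_range m -> in_range m' -> exists a b : R,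
  [/\ (link_pt m).1 - (link_pt m').1 = (m - m') * a,
      (link_pt m).2 - (link_pt m').2 = (m - m') * b,
      0 <= a <= 4 & b <= - 5].
Proof.
move=> r r'.
have /andP[r1 r2] := link_ratio r; have /andP[r1' r2'] := link_ratio r'.
case/andP: r => m1 m2; case/andP: r' => m1' m2'.
pose q := ((2 * m - 1) * (2 * m' - 1))^-1.
have d0 : 2 * m - 1 != 0 by apply: lt0r_neq0; lra.
have d0' : 2 * m' - 1 != 0 by apply: lt0r_neq0; lra.
have rq : m / (2 * m - 1) - m' / (2 * m' - 1) = - (m - m') * q.
  by rewrite /q; field; rewrite d0 d0'.
have q1 : 3 <= q <= 4.
  have p0 : 0 < (2 * m - 1) * (2 * m' - 1) by nra.
  rewrite /q -[3]invrK -[4]invrK !lef_pV2 ?posrE ?invr_gt0 //; apply/andP; split.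
    have : 3^-1 = 1 / 3 :> R by lra.
    by move=> ->; nra.
  have : 4^-1 = 1 / 4 :> R by lra.
  by move=> ->; nra.
case/andP: q1 => q1 q2.
exists (1 - m - m' + q).
exists (m + m' + 4 * h ^+ 2 * (m + m' - 1) - q * (m / (2 * m - 1) + m' / (2 * m' - 1))).
rewrite /link_pt /=; move: rq.
move: (m / (2 * m - 1)) (m' / (2 * m' - 1)) r1 r2 r1' r2' => r r' r1 r2 r1' r2' rq.
split.
- have -> : m - m ^+ 2 - h ^+ 2 - r - (m' - m' ^+ 2 - h ^+ 2 - r') =
   (m - m') * (1 - m - m') - (r - r') by ring.
  by rewrite rq; ring.
- have -> : m ^+ 2 + h ^+ 2 + h ^+ 2 * (2 * m - 1) ^+ 2 + r ^+ 2 -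
    (m' ^+ 2 + h ^+ 2 + h ^+ 2 * (2 * m' - 1) ^+ 2 + r' ^+ 2) =
    (m - m') * (m + m' + 4 * h ^+ 2 * (m + m' - 1)) + (r - r') * (r + r') by ring.
  by rewrite rq; ring.
- by apply/andP; split; lra.
- have hm : h ^+ 2 * (m + m' - 1) <= 1 / 10.
    have h2 := h_sq; have h3 := sqr_ge0 h.
    by move: (h ^+ 2) h2 h3 => H h2 h3; nra.
  have qr : 8 <= q * (r + r') by nra.
  by lra.
Qed.

Lemma link_near m m' : in_range m -> in_range m' ->
  close_to (link_pt m) (link_pt m').
Proof.
move=> r r'; split; last first.
  have [] := link_box r; have [] := link_box r'.
  by move=> *; rewrite ler_norml; apply/andP; split; lra.
have [a [b [-> -> /andP[a0 a1] b0]]] := link_diff r r'.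
rewrite !normrM ler_wpM2l ?normr_ge0 // ger0_norm // ler0_norm; last by lra.
by lra.
Qed.

Let sqrB_sym (a b : R) : (a - b) ^+ 2 = (b - a) ^+ 2.
Proof. by ring. Qed.

(** The coefficients of [link_pt] are chosen to make the factor d^2 - h^2 appear: the slack vanishes
    at d = h and d = -h. The other factor is close to 7/4 near m = 3/4, so the slack is nonnegative
    once |d| >= h. *)
Lemma tangent_link_slack m d : in_range m ->
  (link_pt m).2 - (tangent_pt (m + d)).2 -
    ((link_pt m).1 - (tangent_pt (m + d)).1) ^+ 2 =
  (d ^+ 2 - h ^+ 2) * (2 * (m / (2 * m - 1)) - 1 - (2 * m - 1) ^+ 2 -
    (d ^+ 2 - h ^+ 2) - 2 * (2 * m - 1) * d).
Proof.
case/andP=> m1 m2; have : 2 * m - 1 != 0 by apply: lt0r_neq0; lra.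
by rewrite /link_pt /tangent_pt /= => ?; field.
Qed.

Lemma tangent_link_le m t : in_range m -> in_range t -> h ^+ 2 <= (t - m) ^+ 2 ->
  ((tangent_pt t).1 - (link_pt m).1) ^+ 2 <= (link_pt m).2 - (tangent_pt t).2.
Proof.
move=> mr tr hd; have mt : m + (t - m) = t by ring.
have := tangent_link_slack (t - m) mr; rewrite mt.
rewrite (sqrB_sym (link_pt m).1) -subr_ge0 => ->.
have /andP[r1 r2] := link_ratio mr.
case/andP: mr => m1 m2; case/andP: tr => t1 t2.
move: (m / _) r1 r2 => r r1 r2.
have s2 : (2 * m - 1) ^+ 2 <= 1 by nra.
have d2 : (t - m) ^+ 2 <= 1 / 100 by nra.
have d3 : (2 * m - 1) * (t - m) <= 1 / 100 by nra.
have h2 : 0 <= h ^+ 2 by rewrite sqr_ge0.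
by rewrite mulr_ge0 //; lra.
Qed.

Lemma tangent_link_eq m t : in_range m -> (t - m) ^+ 2 = h ^+ 2 ->
  ((tangent_pt t).1 - (link_pt m).1) ^+ 2 = (link_pt m).2 - (tangent_pt t).2.
Proof.
move=> mr hd; have mt : m + (t - m) = t by ring.
have := tangent_link_slack (t - m) mr; rewrite mt hd.
rewrite subrr mul0r (sqrB_sym (link_pt m).1).
by move=> /eqP; rewrite subr_eq0 eq_sym => /eqP.
Qed.

End Clusters.

(** * Area estimates within and across the families *)

Section Boxes.
Variable R : realType.
Implicit Types p q r : R * R.

(* The boxes surround the line [x = 0] and the values of [tangent_pt] and
   [link_pt] at [m = 3 / 4], [h = 0]. *)
Definition in_box (a : nat) p : Prop :=
  match a with
  | 0 => p = (0, 0)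
  | 1 => [/\ 9 / 16 <= p.2, p.2 <= 9 / 16 + 1 / 20, 3 / 16 - 1 / 100 <= p.1,
      p.1 <= 3 / 16 & (p.1 + p.2) ^+ 2 = p.2]
  | _ => [/\ 45 / 16 - 1 / 20 <= p.2, p.2 <= 45 / 16 + 1 / 20,
      - 21 / 16 - 1 / 50 <= p.1 & p.1 <= - 21 / 16 + 1 / 50]
  end.

Lemma far_box a b p q : (a < b < 3)%N -> in_box a p -> in_box b q ->
  far_from p q /\ ((p.1 + p.2) - (q.1 + q.2)) ^+ 2 <= `|p.2 - q.2|.
Proof.
case: a b => [|[|[|a]]] [|[|[|b]]] //=; rewrite ?andbF // => _; rewrite /far_from.
- move=> -> [q1 q2 q3 q4 q5] /=; rewrite !sub0r !normrN addr0 sub0r sqrrN q5.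
  by rewrite !ger0_norm; [split; [split|]|..]; lra.
- move=> -> [q1 q2 q3 q4] /=; rewrite !sub0r !normrN addr0 sub0r sqrrN.
  rewrite (ler0_norm (x := q.1)); last by lra.
  rewrite ger0_norm; last by lra.
  by split; [split; lra|nra].
- move=> [p1 p2 p3 p4 _] [q1 q2 q3 q4].
  rewrite (ger0_norm (x := p.1 - q.1)); last by lra.
  rewrite ler0_norm; last by lra.
  have d1 : p.1 + p.2 - (q.1 + q.2) <= 0 by lra.
  have d2 : -1 <= p.1 + p.2 - (q.1 + q.2) by lra.
  by split; [split; lra|nra].
Qed.

Lemma far_box_neq a b p q : (a < 3)%N -> (b < 3)%N -> a != b ->
  in_box a p -> in_box b q ->
  far_from p q /\ ((p.1 + p.2) - (q.1 + q.2)) ^+ 2 <= `|p.2 - q.2|.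
Proof.
move=> a3 b3 ab pa qb; case: (ltngtP a b) ab => // ab _.
  by apply: (far_box _ pa qb); rewrite ab b3.
have [|f e] := far_box _ qb pa; first by rewrite ab a3.
split; first exact: far_from_sym.
by rewrite distrC -sqrrN opprB.
Qed.

(** With c the slope difference, the traces at height y differ by at most 2c, and 4c^2 <= c since c
    <= 1/10. *)
Lemma near_horizontal (y : R) p q : close_to p q -> 0 <= y <= 1 ->
  ((p.1 + p.2 * y) - (q.1 + q.2 * y)) ^+ 2 <= `|p.2 - q.2|.
Proof.
move=> [n1 n2] /andP[y0 y1].
have -> : (p.1 + p.2 * y) - (q.1 + q.2 * y) =
  (p.1 - q.1) + (p.2 - q.2) * y by ring.
rewrite -real_normK ?num_real //.
have h1 := ler_normD (p.1 - q.1) ((p.2 - q.2) * y).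
rewrite normrM (ger0_norm y0) in h1.
move: n1 n2 h1 (normr_ge0 (p.1 - q.1 + (p.2 - q.2) * y)) (normr_ge0 (p.1 - q.1)).
move: `|p.1 - q.1 + (p.2 - q.2) * y| `|p.1 - q.1| `|p.2 - q.2|.
move=> D x c n1 n2 h1 D0 x0.
have D1 : D <= 2 * c by nra.
have D2 : D ^+ 2 <= (2 * c) ^+ 2 by rewrite lerXn2r // nnegrE; lra.
by nra.
Qed.

Lemma small3_boxes p q r : in_box 0 p -> in_box 1 q -> in_box 2 r ->
  small3 p q r.
Proof.
move=> /= -> [q1 q2 q3 q4 _] [r1 r2 r3 r4]; rewrite /small3.
have -> : ddet (0, 0) q r = q.1 * r.2 - r.1 * q.2 by rewrite /ddet /=; ring.
have -> : (0 - q.2) * (q.2 - r.2) * (0 - r.2) = - (q.2 * r.2 * (r.2 - q.2)).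
  by ring.
(* The bounds below suffice: (8/5)^2 < 3 = (3/2) * 2. *)
have qr : 3 / 2 <= q.2 * r.2 by nra.
have d0 : 2 <= r.2 - q.2 by lra.
rewrite normrN ger0_norm; last by nra.
have D0 : 0 <= q.1 * r.2 - r.1 * q.2 by nra.
have D1 : q.1 * r.2 - r.1 * q.2 <= 8 / 5 by nra.
by move: (q.1 * _ - _) (q.2 * r.2) (r.2 - q.2) qr d0 D0 D1 => D P d; nra.
Qed.

Lemma ground_box b p q : (0 < b < 3)%N -> in_box 0 p -> in_box b q ->
  (p.1 - q.1) ^+ 2 <= `|p.2 - q.2|.
Proof.
case: b => [|[|[|b]]] //= _ -> [q1 q2 q3 q4] => [q5|];
  by rewrite /= !sub0r sqrrN normrN ger0_norm; nra.
Qed.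

End Boxes.

(** * The arrangement and its triangles of area 1/2 *)

Section Configuration.
Variables (R : realType) (n : nat).

Definition mesh : R := (300 * n.+1%:R)^-1.
Definition node (k : nat) : R := 3 / 4 + k%:R * mesh.

(** The values at 0 and 1 are defaults, replaced in [conf] by the lines y = 0 and y = 1; index 2 is
    the line x = 0. From 3 on, tangents and links alternate, so that each link sits one mesh away
    from its neighbouring tangents. *)
Definition conf_pt (i : nat) : R * R :=
  if i is k.+3 then
    if odd k then link_pt mesh (node k) else tangent_pt (node k)
  else (0, 0).

Definition conf (i : nat) : R * R * R :=
  match i with
  | 0 => horizontal 0
  | 1 => horizontal 1
  | _ => slanted (conf_pt i)
  end.

Definition kind (i : nat) : nat :=
  if i is k.+3 then (if odd k then 2 else 1)%N else 0%N.

Lemma mesh_gt0 : 0 < mesh.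
Proof. by rewrite invr_gt0 mulr_gt0. Qed.

Lemma mesh_le : mesh <= 1 / 300.
Proof.
rewrite /mesh invfM div1r ger_pMr ?invr_gt0 // invf_le1 //.
by rewrite ler1n.
Qed.

Lemma node_in_range k : (k <= n)%N -> in_range (node k).
Proof.
move=> kn; rewrite /in_range /node lerDl lerD2l mulr_ge0 ?(ltW mesh_gt0) //=.
rewrite /mesh invfM mulrCA div1r ger_pMr ?invr_gt0 //.
by rewrite ler_pdivrMr // mul1r ler_nat ltnW.
Qed.

Lemma node_dist k k' : k != k' -> mesh ^+ 2 <= (node k - node k') ^+ 2.
Proof.
move=> kk'; have -> : node k - node k' = mesh * (k%:R - k'%:R).
  by rewrite /node; ring.
rewrite exprMn ler_peMr ?sqr_ge0 //.
have [lt|lt] : (k < k')%N \/ (k' < k)%N by lia.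
  have : k%:R + 1 <= k'%:R :> R by rewrite natr1 ler_nat.
  by nra.
have : k'%:R + 1 <= k%:R :> R by rewrite natr1 ler_nat.
by nra.
Qed.

Lemma node_step k : (node k.+1 - node k) ^+ 2 = mesh ^+ 2.
Proof. by rewrite /node -natr1; ring. Qed.

Lemma node_inj k k' : node k = node k' -> k = k'.
Proof.
move=> e; apply/eqP; apply/negP => /negP /node_dist; rewrite e subrr expr0n /=.
by rewrite leNgt exprn_gt0 ?mesh_gt0.
Qed.

Lemma kind_lt3 i : (kind i < 3)%N.
Proof. by case: i => [|[|[|k]]] //=; case: odd. Qed.

Lemma conf_box i : (i <= n)%N -> in_box (kind i) (conf_pt i).
Proof.
case: i => [|[|[|k]]] //= kn; have kr : in_range (node k).
  by apply: node_in_range; lia.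
case: odd => /=; last exact: tangent_box.
exact: (link_box mesh_gt0 mesh_le).
Qed.

Lemma conf_near i j : (i <= n)%N -> (j <= n)%N -> kind i = kind j ->
  close_to (conf_pt i) (conf_pt j).
Proof.
have nearA : close_to (0, 0) ((0, 0) : R * R).
  by split; rewrite /= subrr normr0 //; lra.
case: i => [|[|[|k]]] //= ki; case: j => [|[|[|l]]] //= li;
  try by case: odd.
have kr : in_range (node k) by apply: node_in_range; lia.
have lr : in_range (node l) by apply: node_in_range; lia.
case: odd; case: odd => // _; last exact: tangent_near.
exact: (link_near mesh_gt0 mesh_le).
Qed.

Lemma conf_far i j : (i <= n)%N -> (j <= n)%N -> kind i != kind j ->
  far_from (conf_pt i) (conf_pt j) /\
  (((conf_pt i).1 + (conf_pt i).2) - ((conf_pt j).1 + (conf_pt j).2)) ^+ 2 <=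
  `|(conf_pt i).2 - (conf_pt j).2|.
Proof.
by move=> ni nj k; apply: far_box_neq k _ _; rewrite ?kind_lt3 //; exact: conf_box.
Qed.

(** Either two of the lines have the same kind, and the estimates for close points apply, or the
    three kinds are distinct and [small3_boxes] does. *)
Lemma conf_small3 i j k : (i <= n)%N -> (j <= n)%N -> (k <= n)%N ->
  small3 (conf_pt i) (conf_pt j) (conf_pt k).
Proof.
move=> ni nj nk.
have near2 a b c : (a <= n)%N -> (b <= n)%N -> (c <= n)%N ->
    kind a = kind b -> small3 (conf_pt a) (conf_pt b) (conf_pt c).
  move=> na nb nc ab; have [bc|bc] := eqVneq (kind b) (kind c).
    by apply: small3_near3; apply: conf_near; rewrite ?ab.
  apply: small3_near2; first exact: conf_near.
    by apply: (conf_far na nc _).1; rewrite ab.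
  exact: (conf_far nb nc bc).1.
have [ij|ij] := eqVneq (kind i) (kind j); first exact: near2.
have [jk|jk] := eqVneq (kind j) (kind k).
  by apply/small3_swap12/small3_swap23; exact: near2.
have [ik|ik] := eqVneq (kind i) (kind k).
  by apply/small3_swap23; exact: near2.
have := conf_box ni; have := conf_box nj; have := conf_box nk.
move: (kind_lt3 i) (kind_lt3 j) (kind_lt3 k) ij jk ik.
case: (kind i) => [|[|[|?]]] // _; case: (kind j) => [|[|[|?]]] // _;
  case: (kind k) => [|[|[|?]]] // _ _ _ _ bk bj bi.
- exact: small3_boxes.
- by apply/small3_swap23; exact: small3_boxes.
- by apply/small3_swap12; exact: small3_boxes.
- by apply/small3_swap23/small3_swap12; exact: small3_boxes.
- by apply/small3_swap12/small3_swap23; exact: small3_boxes.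
- by apply/small3_swap12/small3_swap23/small3_swap12; exact: small3_boxes.
Qed.

Lemma conf_ground i j : (i <= n)%N -> (j <= n)%N ->
  ((conf_pt i).1 - (conf_pt j).1) ^+ 2 <= `|(conf_pt i).2 - (conf_pt j).2|.
Proof.
move=> ni nj; have [k|k] := eqVneq (kind i) (kind j).
  have := near_horizontal (y := 0) (conf_near ni nj k).
  by rewrite !mulr0 !addr0; apply; rewrite lexx ler01.
wlog ij : i j ni nj k / (kind i < kind j)%N => [hw|].
  case: (ltngtP (kind i) (kind j)) k => // ij k; first by apply: hw => //; rewrite ltn_eqF.
  rewrite distrC -sqrrN opprB; apply: hw => //.
  by rewrite ltn_eqF.
have [i0|i0] := posnP (kind i).
  have bi := conf_box ni; rewrite i0 in bi.
  by apply: ground_box bi (conf_box nj); rewrite kind_lt3 -i0 ij.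
case: i j ni nj ij i0 {k} => [|[|[|k]]] [|[|[|l]]] //= ni nj.
have kr : in_range (node k) by apply: node_in_range; lia.
have lr : in_range (node l) by apply: node_in_range; lia.
case: (boolP (odd k)) => ok; case: (boolP (odd l)) => ol // _ _.
(* Only a tangent against a link remains; their nodes have opposite parity, hence are at least one
   mesh apart. *)
rewrite [leRHS]distrC; apply: le_trans (ler_norm _).
apply: tangent_link_le => //; apply: node_dist.
by apply: contraNneq ok => ->.
Qed.

Lemma conf_roof i j : (i <= n)%N -> (j <= n)%N ->
  (((conf_pt i).1 + (conf_pt i).2) - ((conf_pt j).1 + (conf_pt j).2)) ^+ 2 <=
  `|(conf_pt i).2 - (conf_pt j).2|.
Proof.
move=> ni nj; have [k|k] := eqVneq (kind i) (kind j).
  have := near_horizontal (y := 1) (conf_near ni nj k).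
  by rewrite !mulr1; apply; rewrite lexx ler01.
exact: (conf_far ni nj k).2.
Qed.

Lemma conf_slope_inj i j : (1 < i <= n)%N -> (1 < j <= n)%N -> i != j ->
  (conf_pt i).2 != (conf_pt j).2.
Proof.
move=> /andP[i1 ni] /andP[j1 nj] ij; have [e|e] := eqVneq (kind i) (kind j); last first.
  have [[_ f] _] := conf_far ni nj e.
  by rewrite -subr_eq0 -normr_eq0; apply: lt0r_neq0; lra.
case: i j i1 j1 ni nj ij e => [|[|[|k]]] [|[|[|l]]] //= _ _ ni nj kl;
  try by case: odd.
have kr : in_range (node k) by apply: node_in_range; lia.
have lr : in_range (node l) by apply: node_in_range; lia.
have kl0 : node k - node l != 0.
  by rewrite subr_eq0; apply: contraNneq kl => /node_inj ->.
case: odd; case: odd => //= _.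
  have [a [b [_ e _ b0]]] := link_diff mesh_gt0 mesh_le kr lr.
  by rewrite -subr_eq0 e mulf_neq0 //; apply: ltr0_neq0; lra.
case/andP: kr => k1 _; case/andP: lr => l1 _.
rewrite -subr_eq0 subr_sqr mulf_neq0 //; apply: lt0r_neq0; lra.
Qed.

Lemma conf_slanted i : (1 < i)%N -> conf i = slanted (conf_pt i).
Proof. by case: i => [|[|i]]. Qed.

Lemma conf_proper i : proper_coef (conf i).
Proof.
case: i => [|[|i]]; [exact: proper_horizontal.. | exact: proper_slanted].
Qed.

Lemma conf_area_le i j k : (i < j)%N -> (j < k)%N -> (k <= n)%N ->
  tri (conf i) (conf j) (conf k) -> area3 (conf i) (conf j) (conf k) <= 1 / 2.
Proof.
move=> ij jk nk; have jn : (j <= n)%N by lia.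
rewrite (@conf_slanted k); last by lia.
case: j ij jk jn => [//|[|j]] ij jk jn.
  have -> : i = 0%N by lia.
  by rewrite /tri cross_horizontals eqxx.
rewrite (@conf_slanted j.+2) //; case: i ij => [|[|i]] ij.
- case/and4P=> _; rewrite cross_slanted subr_eq0 => c _ _.
  by apply: area3_horizontal_le => //; rewrite !mulr0 !addr0; exact: conf_ground.
- case/and4P=> _; rewrite cross_slanted subr_eq0 => c _ _.
  by apply: area3_horizontal_le => //; rewrite !mulr1; exact: conf_roof.
- move=> t; apply: area3_slanted => //; apply: conf_small3 => //; lia.
Qed.

Lemma conf_ground_tri k : (k.+4 <= n)%N ->
  tri (conf 0) (conf k.+3) (conf k.+4) /\
  area3 (conf 0) (conf k.+3) (conf k.+4) = 1 / 2.
Proof.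
move=> kn; have c : (conf_pt k.+3).2 != (conf_pt k.+4).2.
  by apply: conf_slope_inj; lia.
have e : ((conf_pt k.+3).1 - (conf_pt k.+4).1) ^+ 2 =
    `|(conf_pt k.+3).2 - (conf_pt k.+4).2|.
  have kr : in_range (node k) by apply: node_in_range; lia.
  have kr' : in_range (node k.+1) by apply: node_in_range; lia.
  rewrite /=; case: (odd k) => /=.
    rewrite -[LHS]sqrrN opprB (tangent_link_eq kr (node_step k)) ger0_norm //.
    by rewrite -(tangent_link_eq kr (node_step k)) sqr_ge0.
  have st : (node k - node k.+1) ^+ 2 = mesh ^+ 2.
    by rewrite -(node_step k) -sqrrN opprB.
  rewrite (tangent_link_eq kr' st) distrC ger0_norm //.
  by rewrite -(tangent_link_eq kr' st) sqr_ge0.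
split.
  apply: tri_horizontal => //; rewrite !mulr0 !addr0 -subr_eq0 -sqrf_eq0 e.
  by rewrite normr_eq0 subr_eq0.
by apply: area3_horizontal_eq => //; rewrite !mulr0 !addr0.
Qed.

Lemma conf_roof_tri k : (k.*2.+3 <= n)%N ->
  tri (conf 1) (conf 2) (conf k.*2.+3) /\
  area3 (conf 1) (conf 2) (conf k.*2.+3) = 1 / 2.
Proof.
move=> kn; have c : (conf_pt 2).2 != (conf_pt k.*2.+3).2.
  by apply: conf_slope_inj; lia.
have /andP[m1 _] : in_range (node k.*2) by apply: node_in_range; lia.
have ev : conf_pt k.*2.+3 = tangent_pt (node k.*2) by rewrite /= odd_double.
split.
  apply: tri_horizontal => //; rewrite !mulr1 ev /= addr0 subrK eq_sym.
  by apply: lt0r_neq0; lra.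
apply: area3_horizontal_eq => //; rewrite !mulr1 ev /= addr0 subrK !sub0r.
by rewrite sqrrN normrN ger0_norm // sqr_ge0.
Qed.

Lemma conf_inj i j : (i <= n)%N -> (j <= n)%N ->
  locus (conf i) = locus (conf j) -> i = j.
Proof.
move=> ni nj e; apply/eqP; apply/negPn/negP => ij.
have par : cross (conf i) (conf j) = 0.
  apply/(parallel_locus (conf_proper i) (conf_proper j)).
  by left.
wlog lt : i j ni nj e ij par / (i < j)%N => [hw|].
  have [lt|lt] : (i < j)%N \/ (j < i)%N by lia.
    exact: (hw i j).
  by apply: (hw j i) => //; rewrite 1?eq_sym // cross_sym par oppr0.
case: j nj e ij par lt => [//|[|j]] nj e ij par lt.
  move: e; have -> : i = 0%N by lia.
  move=> e; have : locus (horizontal 1) ((0, 0) : R * R).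
    by rewrite -[horizontal 1]/(conf 1) -e /locus /= mul0r mulr0 addr0.
  by rewrite /locus /= => E; lra.
move: par; rewrite (@conf_slanted j.+2) //; case: i ni e ij lt => [|[|i]] ni e ij lt.
- by rewrite cross_horizontal => /eqP; rewrite oppr_eq0 oner_eq0.
- by rewrite cross_horizontal => /eqP; rewrite oppr_eq0 oner_eq0.
- rewrite cross_slanted => /eqP; rewrite subr_eq0; apply/negP.
  by apply: conf_slope_inj; lia.
Qed.

End Configuration.

Lemma M_ge (R : realType) p : (p + p./2 <= M R p.+4)%N.
Proof.
pose n := p.+4; pose L (i : 'I_n) := locus (conf R n i).
have LA : arrangement L.
  split; last by move=> i; apply/is_line_locus/conf_proper.
  by move=> i j /conf_inj e; apply/val_inj/e; exact: ltnW.
apply: leq_trans (M_upper_bound LA).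
have triE (i j k : 'I_n) : triangle L (i, j, k) <-> [&& (i < j)%N, (j < k)%N &
    tri (conf R n i) (conf R n j) (conf R n k)].
  have fE := forms_triangle_locus (conf_proper R n i) (conf_proper R n j)
    (conf_proper R n k).
  by rewrite /triangle; split => [[-> -> /fE]|/and3P[-> -> /fE]].
have maxE (i j k : 'I_n) : (i < j)%N -> (j < k)%N ->
    tri (conf R n i) (conf R n j) (conf R n k) ->
    area3 (conf R n i) (conf R n j) (conf R n k) = 1 / 2 ->
    max_area_triangle L (i, j, k).
  move=> ij jk t e; split; first by apply/triE; rewrite ij jk t.
  move=> [[i' j'] k'] /triE/and3P[ij' jk' t'].
  rewrite /area_of /L !triangle_area_locus // e.
  by apply: conf_area_le => //; exact: ltnW.
(* The nodes 0 to p give p consecutive pairs, each tight with y = 0; the even nodes give tangents,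
   each tight with x = 0 and y = 1, of which the first [p./2] are used. *)
pose f (s : 'I_p + 'I_(p./2)) : triple n :=
  match s with
  | inl k => (inord 0, inord k.+3, inord k.+4)
  | inr k => (inord 1, inord 2, inord (k : nat).*2.+3)
  end.
have vals (i j k i' j' k' : nat) : (i < n)%N -> (j < n)%N -> (k < n)%N ->
    (i' < n)%N -> (j' < n)%N -> (k' < n)%N ->
    (inord i, inord j, inord k) = (inord i', inord j', inord k') :> triple n ->
    [/\ i = i', j = j' & k = k'].
  move=> *; have [e1 e2 e3] : [/\ inord i = inord i' :> 'I_n,
      inord j = inord j' :> 'I_n & inord k = inord k' :> 'I_n] by split; congruence.
  move: e1 e2 e3 => /(congr1 val) e1 /(congr1 val) e2 /(congr1 val) e3.
  by move: e1 e2 e3; rewrite /= !inordK.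
have kn (k : 'I_p) : (k.+4 < n)%N by rewrite /n !ltnS.
have dn (k : 'I_(p./2)) : ((k : nat).*2.+3 < n)%N.
  by have := ltn_ord k; rewrite /n; lia.
have f_inj : injective f.
  move=> [k|k] [l|l] /= /vals[]; rewrite ?kn ?dn ?(ltnW (kn _)) // => ? ? ?.
  - by congr inl; apply: val_inj => /=; lia.
  - by congr inr; apply: val_inj => /=; lia.
have -> : (p + p./2)%N = #|codom f|.
  by rewrite card_codom // card_sum !card_ord.
apply: subset_leq_card; apply/fintype.subsetP => t /codomP[[k|k] ->];
  rewrite inE /=; do 2!apply/asboolP; apply: maxE; rewrite !inordK ?kn ?dn ?(ltnW (kn _)) //.
- have [|//] := @conf_ground_tri R n k; exact: ltnW.
- have [|//] := @conf_ground_tri R n k; exact: ltnW.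
- have [|//] := @conf_roof_tri R n k; exact: ltnW.
- have [|//] := @conf_roof_tri R n k; exact: ltnW.
Qed.

Theorem theorem3 (R : realType) :
  (exists C : R, forall n : nat, 7 / 5 * n%:R - C < (M R n)%:R) /\
  (forall n : nat, (3 <= n)%N -> (M R n)%:R < 2 / 3 * n%:R * (n%:R - 2) :> R).
Proof.
split; last by move=> n; exact: M_lt.
(* For n <= 3 the left side is negative. For n = p + 4 it is 7p/5 - 22/5, below the 3p/2 - 1/2 that
   [M_ge] guarantees. *)
exists 10 => n; case: (ltnP n 4) => [n4|].
  have : n%:R <= 3 :> R by rewrite ler_nat.
  by have : 0 <= (M R n)%:R :> R by []; lra.
case: n => [|[|[|[|p]]]] // _.
have h1 : p%:R + (p./2)%:R <= (M R p.+4)%:R :> R by rewrite -natrD ler_nat M_ge.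
have h2 : 3 * p%:R <= 2 * (p%:R + (p./2)%:R) + 1 :> R.
  by rewrite -natrD -!natrM natr1 ler_nat; lia.
have h3 : 0 <= p%:R :> R by [].
rewrite -[p.+4]addn4 natrD in h1 *.
by move: (M R _)%:R (p%:R : R) (p./2%:R : R) h1 h2 h3 => m x y; lra.
Qed.
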